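(* Every rectifiable simple closed curve $\mathcal{C}\subset\mathbb{S}^2$ of length $L\ge2\pi$ satisfies $$A_{\mathcal{C}}(\theta)\ \le\ 2L\sin\theta,\qquad 0\le\theta\le\vartheta,$$ where $\vartheta\in(0,\pi/2]$ is determined by $\sin\vartheta=2\pi/L$.
   Context: $\mathbb{S}^2$ is the unit sphere in $\mathbb{R}^3$; $\operatorname{dist}(x,\mathcal{C})=\min_{y\in\mathcal{C}}\arccos\langle x,y\rangle$; $T_\theta(\mathcal{C})=\{x\in\mathbb{S}^2:\operatorname{dist}(x,\mathcal{C})\le\theta\}$; $A_{\mathcal{C}}(\theta)=\operatorname{area}(T_\theta(\mathcal{C}))$. *)

(* Defs.v *)
From HB Require Import structures.
From mathcomp Require Import all_boot all_order all_algebra.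
From mathcomp Require Import all_classical all_reals all_analysis.

Set Implicit Arguments.
Unset Strict Implicit.
Unset Printing Implicit Defensive.

Import Order.TTheory GRing.Theory Num.Theory.
Import numFieldNormedType.Exports.

Local Open Scope classical_set_scope.
Local Open Scope ring_scope.

Section SphericalTubes.
Variable R : realType.
Implicit Types (x y : 'rV[R]_3) (C E : set 'rV[R]_3) (gamma : R -> 'rV[R]_3).

Definition inner x y : R := \sum_(i < 3) x ord0 i * y ord0 i.

(* Not the norm `|x| of 'rV[R]_3, which is the max norm (it induces the same
   topology). *)
Definition euclidean_norm x : R := Num.sqrt (inner x x).

Definition unit_sphere : set 'rV[R]_3 := [set x | euclidean_norm x = 1].

(* For C a nonempty compact subset of the sphere and x on the sphere, the
   infimum is attained. *)
Definition sphere_dist x C : R := inf [set acos (inner x y) | y in C].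

Definition tube C (theta : R) : set 'rV[R]_3 :=
  [set x | unit_sphere x /\ sphere_dist x C <= theta].

(* p = (colatitude, longitude) *)
Definition spherical_coordinates (p : R * R) : 'rV[R]_3 :=
  \row_(i < 3)
    [:: sin p.1 * cos p.2; sin p.1 * sin p.2; cos p.1]`_i.

Definition coordinates_domain : set (R * R) := `[0, pi] `*` `[0, 2 * pi].

(* The surface integral of the indicator function of E; the area element of the
   parametrization is sin p.1. *)
Definition sphere_area E : \bar R :=
  (\int[lebesgue_measure \x lebesgue_measure]_(p in
      coordinates_domain `&` spherical_coordinates @^-1` E) (sin p.1)%:E)%E.

Definition tube_area C (theta : R) : \bar R := sphere_area (tube C theta).

Definition simple_closed_curve gamma C : Prop :=
  [/\ {within `[0, 1], continuous gamma},
      gamma 0 = gamma 1,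
      {in `[0, 1[ &, injective gamma}
    & C = gamma @` `[0, 1] ].

(* The subdivision 0 = t_0 < ... < t_n = 1 is encoded by s = [:: t_1; ...; t_n],
   as in itv_partition. *)
Definition polygon_length gamma (s : seq R) : R :=
  \sum_(k < size s)
     euclidean_norm (gamma (nth 1 (0 :: s) k.+1) - gamma (nth 1 (0 :: s) k)).

Definition curve_length gamma : \bar R :=
  ereal_sup [set (polygon_length gamma s)%:E | s in itv_partition 0 1].

End SphericalTubes.

Arguments unit_sphere R : clear implicits.

(* Main.v *)
Require Import Defs.
From HB Require Import structures.
From mathcomp Require Import all_boot all_order all_algebra.
From mathcomp Require Import all_classical all_reals all_analysis.
From mathcomp Require Import measurable_realfun ring lra.

Set Implicit Arguments.
Unset Strict Implicit.
Unset Printing Implicit Defensive.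

Import Order.TTheory GRing.Theory Num.Theory.
Import numFieldNormedType.Exports.

Local Open Scope classical_set_scope.
Local Open Scope ring_scope.

(** Slide a circle of angular radius sigma < pi/2 over the sphere and count how
    often it meets the curve C. Integrated over all centres, the number of
    intersections is at most 4 L sin sigma (Crofton). If a centre x lies within
    sigma of C, then C enters the cap of radius sigma about x; unless that cap
    contains all of C, the closed curve also leaves it, and so meets its boundary
    circle at least twice. Hence twice the area of the tube is at most
    4 L sin sigma as soon as no cap of radius sigma contains C
    ([area_uncovered_curve]). If such a cap does contain C, the tube lies in the
    concentric cap of radius 2 sigma, whose area 4 pi sin^2 sigma is at most
    2 L sin sigma because L >= 2 pi ([area_in_cap]).

    The Crofton inequality reduces to one chord of C, with endpoints a and b at
    angle d: the centres whose circle of radius sigma separates a from b have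
    total area at most 4 d sin sigma ([crofton_bound]). To see this, place a and
    b on the equator at longitudes -d/2 and d/2. On a parallel at height z the
    centres close to a form an arc, those close to b the same arc shifted by d,
    so the two differ by a set of longitudes of measure at most 2 d, and they are
    empty when |z| > sin sigma; the area element in height and longitude is
    dz du.

    Placing a and b on the equator uses rotation invariance of the surface
    integral, which is defined by spherical coordinates. Rotations about the
    polar axis are shifts of the longitude ([sphere_integral_rotz]). Each of the
    hemispheres y > 0 and y < 0 projects onto the unit disc of the (x, z)-plane
    with area element dx dz / |y|, which is symmetric in x and z; therefore
    exchanging x and z preserves the integral as well ([sphere_integral_swap]).
    These maps together move any two unit vectors to the required position
    ([canonical_position]).

    Indicator functions of caps are replaced by continuous ramps, so that all
    changes of variables concern continuous integrands; the curve is replaced by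
    its n + 1 equidistant nodes, and Fatou's lemma recovers the limit. Both
    replacements lose a little, which is absorbed by theta < sigma < tau; the
    theorem follows by letting tau tend to theta. Only theta = pi/2 is left,
    where the bound is at least the area 4 pi of the whole sphere. *)

(** * Integration over the line and over rectangles *)

Section LineIntegrals.
Variable R : realType.
Local Notation mu := (@lebesgue_measure R).
Local Notation M := (measurableTypeR R).

(** The integral of a nonnegative function is a supremum over simple functions
    below it, hence monotone even for nonmeasurable functions and domains. In this
    form it applies directly to tubes. *)
Lemma ge0_le_integral_any d (T : measurableType d) (m : {measure set T -> \bar R})
    (D E : set T) (f g : T -> \bar R) :
  (forall x, 0 <= (f \_ D) x <= (g \_ E) x)%E ->
  (\int[m]_(x in D) f x <= \int[m]_(x in E) g x)%E.
Proof.
move=> fg; rewrite integral_mkcond [leRHS]integral_mkcond !ge0_integralTE; last 2 first.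
- by move=> x; have /andP[/le_trans h /h] := fg x.
- by move=> x; have /andP[] := fg x.
apply: ereal_sup_le => _ [h /= hf <-]; exists h => // x.
by apply: le_trans (hf x) _; have /andP[] := fg x.
Qed.

Lemma tonelli_rect d1 d2 (T1 : measurableType d1) (T2 : measurableType d2)
    (m1 : {sigma_finite_measure set T1 -> \bar R})
    (m2 : {sigma_finite_measure set T2 -> \bar R})
    (A : set T1) (B : set T2) (f : T1 * T2 -> \bar R) :
  measurable A -> measurable B -> measurable_fun [set: T1 * T2] f ->
  (forall x y, A x -> B y -> 0 <= f (x, y))%E ->
  (\int[(m1 \x m2)%E]_(p in A `*` B) f p = \int[m1]_(x in A) \int[m2]_(y in B) f (x, y))%E /\
  (\int[(m1 \x m2)%E]_(p in A `*` B) f p = \int[m2]_(y in B) \int[m1]_(x in A) f (x, y))%E.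
Proof.
move=> mA mB mf f0; rewrite integral_mkcond.
have m : measurable_fun [set: T1 * T2] (f \_ (A `*` B)).
  have [+ _] := measurable_restrictT f (measurableX mA mB); apply.
  exact: measurable_funTS.
have p x : (0 <= (f \_ (A `*` B)) x)%E.
  by case: x => [x y]; rewrite patchE; case: ifPn => //; rewrite inE => -[] /=; exact: f0.
split.
- rewrite fubini_tonelli1// [RHS]integral_mkcond; apply: eq_integral => x _.
  rewrite /fubini_F [RHS]patchE; case: ifPn => xA.
    rewrite [RHS]integral_mkcond; apply: eq_integral => y _.
    by rewrite !patchE in_setX xA.
  by apply: integral0_eq => y _; rewrite patchE in_setX (negbTE xA).
- rewrite fubini_tonelli2// [RHS]integral_mkcond; apply: eq_integral => y _.
  rewrite /fubini_G [RHS]patchE; case: ifPn => yB.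
    rewrite [RHS]integral_mkcond; apply: eq_integral => x _.
    by rewrite !patchE in_setX yB andbT.
  by apply: integral0_eq => x _; rewrite patchE in_setX (negbTE yB) andbF.
Qed.

Implicit Types (F G : R -> R) (a b c : R).

Lemma continuous_EFin_measurable F (D : set M) : continuous F ->
  measurable_fun D (fun x : M => (F x)%:E).
Proof.
move=> cF; apply/measurable_EFinP; apply: measurable_funTS.
exact: continuous_measurable_fun.
Qed.

Lemma integral_itv_cat F a b c : continuous F -> (forall x, 0 <= F x) ->
  a <= b -> b <= c ->
  (\int[mu]_(x in `[a, c]) (F x)%:E =
   \int[mu]_(x in `[a, b]) (F x)%:E + \int[mu]_(x in `[b, c]) (F x)%:E)%E.
Proof.
move=> cF F0 ab bc.
rewrite -[X in (_ + X)%E]integral_itv_obnd_cbnd; last first.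
  exact: continuous_EFin_measurable.
rewrite -ge0_integral_setU//=.
- congr (integral _ _ _); apply/seteqP; split => x /=; rewrite !in_itv/=.
    by move=> /andP[ax xc]; case: (leP x b) => xb; [left|right]; rewrite ?ax ?xb ?xc.
  by case=> /andP[? ?]; apply/andP; split; lra.
- exact: continuous_EFin_measurable.
- by move=> x _; rewrite lee_fin.
- apply/disj_set2P/seteqP; split => x //= [].
  by rewrite !in_itv/= => /andP[_ xb] /andP[bx _]; move: (lt_le_trans bx xb); rewrite ltxx.
Qed.

Lemma integral_shift F a b c : continuous F -> a <= b ->
  (\int[mu]_(x in `[a, b]) (F (x + c))%:E =
   \int[mu]_(x in `[(a + c)%R, (b + c)%R]) (F x)%:E)%E.
Proof.
move=> cF ab.
have d (x : R) : is_derive x (1 : R) (fun y : R => y + c) 1.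
  have -> : (fun y : R => y + c) = (@id R + cst c)%R by [].
  by apply: is_derive_eq; rewrite addr0.
have d1 : derive1 (fun y : R => y + c) = cst 1.
  by apply/funext => x; rewrite derive1E derive_val.
have cs : continuous (fun y : R => y + c).
  by move=> x; apply: cvgD; [exact: cvg_id|exact: cvg_cst].
rewrite (@integration_by_substitution_increasing _ (fun x => x + c) F)//.
- apply: eq_integral => x _; congr EFin.
  by rewrite /= d1 /= mulr1.
- by move=> x y _ _; rewrite ltrD2r.
- by rewrite d1 => x _; exact: cvg_cst.
- by rewrite d1; apply: is_cvg_cst.
- by rewrite d1; apply: is_cvg_cst.
- split.
  + by move=> x _; apply: ex_derive.
  + by apply: cvg_at_right_filter; exact: cs.
  + by apply: cvg_at_left_filter; exact: cs.
- exact: continuous_subspaceT.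
Qed.

(** Shifting by c moves the window over one period; for c >= 0 the part that
    leaves on the left is the part that enters on the right. Negative shifts are
    inverted. *)
Lemma integral_period F c : continuous F -> (forall x, 0 <= F x) ->
  (forall x, F (x + 2 * pi) = F x) -> `|c| <= 2 * pi ->
  (\int[mu]_(x in `[0%R, (2 * pi)%R]) (F (x + c))%:E =
   \int[mu]_(x in `[0%R, (2 * pi)%R]) (F x)%:E)%E.
Proof.
have p0 : 0 <= 2 * pi :> R by rewrite mulr_ge0// pi_ge0.
have main (G : R -> R) (d : R) : continuous G -> (forall x, 0 <= G x) ->
    (forall x, G (x + 2 * pi) = G x) -> 0 <= d <= 2 * pi ->
    (\int[mu]_(x in `[0%R, (2 * pi)%R]) (G (x + d))%:E =
     \int[mu]_(x in `[0%R, (2 * pi)%R]) (G x)%:E)%E.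
  move=> cG G0 Gp /andP[d0 d2]; rewrite integral_shift// add0r.
  rewrite (integral_itv_cat cG G0 d2); last by rewrite lerDl.
  rewrite [RHS](integral_itv_cat cG G0 d0 d2) addeC; congr (_ + _)%E.
  have -> : 2 * pi + d = d + 2 * pi by rewrite addrC.
  rewrite -{1}[2 * pi]add0r -integral_shift//.
  by under eq_integral do rewrite Gp.
move=> cF F0 Fp; rewrite ler_norml => /andP[c1 c2].
case: (leP 0 c) => c0; first by apply: main; rewrite ?c0.
rewrite -(main (fun x => F (x + c)) (- c)).
- by apply: eq_integral => x _; rewrite subrK.
- move=> x; apply: continuous_comp; last exact: cF.
  by apply: cvgD; [exact: cvg_id|exact: cvg_cst].
- by move=> x; exact: F0.
- by move=> x; rewrite -addrA (addrC (2 * pi)) addrA Fp.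
- by apply/andP; split; lra.
Qed.

(** The substitution x = a cos u is decreasing on the first half-period and
    increasing on the second: the two halves of a circle of radius a project onto
    the same diameter. *)
Lemma integral_cosine F a : continuous F -> 0 <= a ->
  (\int[mu]_(x in `[(- a)%R, a]) (F x)%:E =
   \int[mu]_(u in `[0%R, pi]) (F (a * cos u) * (a * sin u))%:E)%E /\
  (\int[mu]_(x in `[(- a)%R, a]) (F x)%:E =
   \int[mu]_(u in `[pi, (2 * pi)%R]) (F (a * cos u) * - (a * sin u))%:E)%E.
Proof.
move=> cF; rewrite le_eqVlt => /predU1P[<-|a0].
  rewrite oppr0 set_itv1 integral_set1; split; apply/esym/integral0_eq => x _;
    by rewrite !mul0r ?oppr0 mulr0.
have d (x : R) : is_derive x (1 : R) (fun y : R => a * cos y) (- (a * sin x)).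
  have -> : (fun y : R => a * cos y) = (cst a * @cos R)%R by [].
  by apply: is_derive_eq; rewrite /= scaler0 addr0 /GRing.scale/= mulrN.
have d1 : derive1 (fun y : R => a * cos y) = (fun x => - (a * sin x)).
  by apply/funext => x; rewrite derive1E derive_val.
have cs : continuous (fun y : R => a * cos y).
  by move=> x; apply: cvgM; [exact: cvg_cst|exact: continuous_cos].
have csn : continuous (fun y : R => - (a * sin y)).
  by move=> x; apply: cvgN; apply: cvgM; [exact: cvg_cst|exact: continuous_sin].
have c2pi : cos (2 * pi) = 1 :> R by rewrite mulr_natl cos2pi.
have p0 := pi_ge0 R.
split.
- have := @integration_by_substitution_decreasing _ (fun x => a * cos x) F 0 pi.
  rewrite /= cospi cos0 mulrN !mulr1 => -> //.
  + by apply: eq_integral => x _; congr EFin; rewrite !fctE d1 opprK.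
  + by move=> x y x0 y0 yx; rewrite ltr_pM2l// ltr_cos.
  + by rewrite d1 => x _; exact: csn.
  + by rewrite d1; apply/cvg_ex; eexists; apply: cvg_at_right_filter; exact: csn.
  + by rewrite d1; apply/cvg_ex; eexists; apply: cvg_at_left_filter; exact: csn.
  + split.
    * by move=> x _; apply: ex_derive.
    * by apply: cvg_at_right_filter; exact: cs.
    * by apply: cvg_at_left_filter; exact: cs.
  + exact: continuous_subspaceT.
- have := @integration_by_substitution_increasing _ (fun x => a * cos x) F pi (2 * pi).
  rewrite /= cospi c2pi mulrN !mulr1 => -> //.
  + by apply: eq_integral => x _; congr EFin; rewrite !fctE d1.
  + by lra.
  + move=> x y; rewrite !in_itv/= => /andP[x0 x1] /andP[y0 y1] yx; rewrite ltr_pM2l//.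
    have E z : cos z = cos (2 * pi - z) :> R.
      by rewrite cosB c2pi mulr_natl sin2pi mul1r mul0r addr0.
    by rewrite (E x) (E y) ltr_cos ?in_itv/=; lra.
  + by rewrite d1 => x _; exact: csn.
  + by rewrite d1; apply/cvg_ex; eexists; apply: cvg_at_right_filter; exact: csn.
  + by rewrite d1; apply/cvg_ex; eexists; apply: cvg_at_left_filter; exact: csn.
  + split.
    * by move=> x _; apply: ex_derive.
    * by apply: cvg_at_right_filter; exact: cs.
    * by apply: cvg_at_left_filter; exact: cs.
  + exact: continuous_subspaceT.
Qed.

End LineIntegrals.

(** * The surface integral and rotations about the polar axis *)

Section SphereIntegral.
Variable R : realType.
Local Notation mu := (@lebesgue_measure R).
Local Notation M := (measurableTypeR R).
Local Notation vec := (R * R * R)%type.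

Definition sphere_point (p : R * R) : R * R * R :=
  (sin p.1 * cos p.2, sin p.1 * sin p.2, cos p.1).

(** Functions live on the ambient space, so that coordinate changes can be
    written as compositions. *)
Definition sphere_integral (f : R * R * R -> R) : \bar R :=
  \int[(mu \x mu)%E]_(p in @coordinates_domain R) (f (sphere_point p) * sin p.1)%:E.

(** Continuity serves the one-dimensional changes of variables, and
    measurability the exchange of the order of integration. *)
Definition admissible (f : R * R * R -> R) :=
  [/\ continuous f, measurable_fun [set: (M * M * M)%type] (f : M * M * M -> R)
    & forall v, 0 <= f v].

Lemma measurable_sphere_point :
  measurable_fun [set: (M * M)%type] (sphere_point : M * M -> M * M * M).
Proof.
have m1 : measurable_fun [set: (M * M)%type] (fun p : M * M => p.1).
  exact: measurable_fst.
have m2 : measurable_fun [set: (M * M)%type] (fun p : M * M => p.2).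
  exact: measurable_snd.
have ms : measurable_fun [set: M] (sin : M -> M).
  by apply: continuous_measurable_fun; exact: continuous_sin.
have mc : measurable_fun [set: M] (cos : M -> M).
  by apply: continuous_measurable_fun; exact: continuous_cos.
apply: measurable_fun_pair; last exact: (measurableT_comp mc m1).
by apply: measurable_fun_pair; apply: measurable_funM; apply: measurableT_comp.
Qed.

Lemma measurable_sphere_integrand f : admissible f ->
  measurable_fun [set: (M * M)%type] (fun p : M * M => (f (sphere_point p) * sin p.1)%:E).
Proof.
move=> [_ mf _]; apply/measurable_EFinP; apply: measurable_funM.
  exact: (measurableT_comp mf measurable_sphere_point).
apply: (@measurableT_comp _ _ _ _ _ _ (sin : M -> R)); last exact: measurable_fst.
by apply: continuous_measurable_fun; exact: continuous_sin.
Qed.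

Lemma sphere_integralE f : admissible f -> sphere_integral f =
  (\int[mu]_(t in `[0%R, pi]) \int[mu]_(u in `[0%R, (2 * pi)%R])
    (f (sin t * cos u, sin t * sin u, cos t) * sin t)%:E)%E.
Proof.
move=> af; have [_ _ f0] := af.
rewrite /sphere_integral /coordinates_domain.
have -> := (tonelli_rect mu mu _ _ (measurable_sphere_integrand af) _).1 => //.
by move=> t u t0 _; rewrite lee_fin mulr_ge0// sin_ge0_pi.
Qed.

Lemma continuous_pair (T U V : topologicalType) (f : T -> U) (g : T -> V) :
  continuous f -> continuous g -> continuous (fun x => (f x, g x)).
Proof. by move=> cf cg x; exact: (cvg_pair (cf x) (cg x)). Qed.

(** [admissible] without positivity; this version is closed under algebraic
    operations. *)
Definition tame (g : R * R * R -> R) :=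
  continuous g /\ measurable_fun [set: (M * M * M)%type] (g : M * M * M -> R).

Lemma tame_x : tame (fun v => v.1.1).
Proof.
split; last exact: (measurableT_comp measurable_fst measurable_fst).
by move=> v; apply: (@continuous_comp _ _ _ fst fst) => ?; exact: cvg_fst.
Qed.

Lemma tame_y : tame (fun v => v.1.2).
Proof.
split; last exact: (measurableT_comp measurable_snd measurable_fst).
by move=> v; apply: (@continuous_comp _ _ _ fst snd) => ?; [exact: cvg_fst|exact: cvg_snd].
Qed.

Lemma tame_z : tame (fun v => v.2).
Proof. by split; [move=> ?; exact: cvg_snd|exact: measurable_snd]. Qed.

Lemma tame_cst c : tame (fun=> c).
Proof. by split; [move=> ?; exact: cvg_cst|exact: measurable_cst]. Qed.

Lemma tameD f g : tame f -> tame g -> tame (fun v => f v + g v).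
Proof.
move=> [cf mf] [cg mg]; split; last exact: measurable_funD.
by move=> v; apply: cvgD; [exact: cf|exact: cg].
Qed.

Lemma tameM f g : tame f -> tame g -> tame (fun v => f v * g v).
Proof.
move=> [cf mf] [cg mg]; split; last exact: measurable_funM.
by move=> v; apply: cvgM; [exact: cf|exact: cg].
Qed.

Lemma tame_comp (h : R -> R) f : continuous h -> tame f -> tame (fun v => h (f v)).
Proof.
move=> ch [cf mf]; split.
  by move=> v; apply: continuous_comp; [exact: cf|exact: ch].
have mh : measurable_fun [set: R] h by exact: continuous_measurable_fun.
exact: (measurableT_comp mh mf).
Qed.

Lemma tame_subst f g1 g2 g3 : tame f -> tame g1 -> tame g2 -> tame g3 ->
  tame (fun v => f (g1 v, g2 v, g3 v)).
Proof.
move=> [cf mf] [c1 m1] [c2 m2] [c3 m3]; split.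
  move=> v.
  apply: (@continuous_comp _ _ _ (fun v => (g1 v, g2 v, g3 v)) f); last exact: cf.
  by apply: continuous_pair => //; exact: continuous_pair.
have mg : measurable_fun [set: (M * M * M)%type]
    ((fun v => (g1 v, g2 v, g3 v)) : M * M * M -> M * M * M).
  by apply: measurable_fun_pair => //; exact: measurable_fun_pair.
exact: (measurableT_comp mf mg).
Qed.

Lemma admissible_tame f : tame f -> (forall v, 0 <= f v) -> admissible f.
Proof. by move=> [? ?] ?. Qed.

Lemma tame_admissible f : admissible f -> tame f.
Proof. by case. Qed.

Definition rotz (c : R) (v : vec) : vec :=
  (cos c * v.1.1 - sin c * v.1.2, sin c * v.1.1 + cos c * v.1.2, v.2).

Lemma sphere_integral_rotz f c : admissible f -> `|c| <= 2 * pi ->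
  sphere_integral (f \o rotz c) = sphere_integral f.
Proof.
move=> af cpi; have [cf mf f0] := af.
rewrite !sphere_integralE//; last first.
  apply: admissible_tame => [|v]; last exact: f0.
  apply: (@tame_subst f (fun v => cos c * v.1.1 - sin c * v.1.2)
    (fun v => sin c * v.1.1 + cos c * v.1.2) (fun v => v.2)).
  - exact: tame_admissible.
  - apply: tameD; first by apply: tameM; [exact: tame_cst|exact: tame_x].
    apply: (@tame_comp (fun x => - x)); first exact: opp_continuous.
    by apply: tameM; [exact: tame_cst|exact: tame_y].
  - by apply: tameD; apply: tameM;
      [exact: tame_cst|exact: tame_x|exact: tame_cst|exact: tame_y].
  - exact: tame_z.
apply: eq_integral => t; rewrite inE/= => t0.
have s0 : 0 <= sin t by apply: sin_ge0_pi; rewrite in_itv in t0.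
rewrite -(@integral_period _ (fun u => f (sin t * cos u, sin t * sin u, cos t) * sin t) c)//.
- apply: eq_integral => u _; rewrite /rotz /= cosD sinD.
  by congr (EFin (f (_, _, _) * _)); ring.
- move=> u; apply: cvgM; last exact: cvg_cst.
  apply: (@continuous_comp _ _ _ (fun u => (sin t * cos u, sin t * sin u, cos t)) f);
    last exact: cf.
  apply: continuous_pair; last by move=> ?; exact: cvg_cst.
  apply: continuous_pair => v; apply: cvgM;
    [exact: cvg_cst|exact: continuous_cos|exact: cvg_cst|exact: continuous_sin].
- by move=> u; rewrite mulr_ge0.
- by move=> u; rewrite (mulr_natl pi 2) cosD2pi sinD2pi.
Qed.

End SphereIntegral.

(** * Invariance under exchange of the first and third coordinates *)

Section CoordinateExchange.
Variable R : realType.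
Local Notation mu := (@lebesgue_measure R).
Local Notation M := (measurableTypeR R).

(** The sum of k over the two points of the sphere above (x, z), weighted by
    y = |y|. With the area element dx dz / y, this is the density of y^2 k
    projected along the second axis. Since the square root vanishes on negative
    numbers, the density is continuous on the whole plane and vanishes outside
    the unit disc. *)
Definition sheet_sum (k : R * R * R -> R) (p : R * R) : R :=
  let y := Num.sqrt (1 - p.1 ^+ 2 - p.2 ^+ 2) in
  y * (k (p.1, y, p.2) + k (p.1, - y, p.2)).

Lemma sqr_continuous : continuous (fun x : R => x ^+ 2).
Proof. by move=> x; apply: exprn_continuous. Qed.

Lemma sheet_height_continuous :
  continuous (fun p : R * R => Num.sqrt (1 - p.1 ^+ 2 - p.2 ^+ 2)).
Proof.
move=> p; apply: (@continuous_comp _ _ _ (fun p : R * R => 1 - p.1 ^+ 2 - p.2 ^+ 2) Num.sqrt);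
  last exact: sqrt_continuous.
apply: cvgB; first apply: cvgB; first exact: cvg_cst.
- by apply: (@continuous_comp _ _ _ fst (fun x : R => x ^+ 2));
    [exact: cvg_fst|exact: sqr_continuous].
- by apply: (@continuous_comp _ _ _ snd (fun x : R => x ^+ 2));
    [exact: cvg_snd|exact: sqr_continuous].
Qed.

Lemma sheet_sum_continuous k : continuous k -> continuous (sheet_sum k).
Proof.
move=> ck.
have cfst : continuous (fst : R * R -> R) by move=> ?; exact: cvg_fst.
have csnd : continuous (snd : R * R -> R) by move=> ?; exact: cvg_snd.
have ch := sheet_height_continuous.
move=> p; apply: cvgM; first exact: ch.
by apply: cvgD; apply: (@continuous_comp _ _ _ _ k); try exact: ck;
  apply: continuous_pair => //; apply: continuous_pair => //;
  move=> q; apply: cvgN; exact: ch.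
Qed.

Lemma measurable_sheet_sum k : tame k ->
  measurable_fun [set: (M * M)%type] (sheet_sum k : M * M -> R).
Proof.
move=> [_ mk].
have m1 : measurable_fun [set: (M * M)%type] (fst : M * M -> R) by exact: measurable_fst.
have m2 : measurable_fun [set: (M * M)%type] (snd : M * M -> R) by exact: measurable_snd.
have my : measurable_fun [set: (M * M)%type]
    ((fun p => Num.sqrt (1 - p.1 ^+ 2 - p.2 ^+ 2)) : M * M -> R).
  apply: (measurableT_comp (continuous_measurable_fun (@sqrt_continuous R))).
  apply: measurable_funB; first apply: measurable_funB; first exact: measurable_cst.
    exact: measurable_funX.
  exact: measurable_funX.
apply: measurable_funM => //; apply: measurable_funD;
  apply: (measurableT_comp mk); apply: measurable_fun_pair => //;
  apply: measurable_fun_pair => //; exact: measurable_funN.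
Qed.

Lemma sheet_sum_ge0 k p : (forall v, 0 <= k v) -> 0 <= sheet_sum k p.
Proof. by move=> k0; rewrite mulr_ge0 ?sqrtr_ge0// addr_ge0. Qed.

Lemma continuous_slice_x (f : R * R -> R) (c : R) :
  continuous f -> continuous (fun x => f (x, c)).
Proof.
move=> cf x; apply: (@continuous_comp _ _ _ (fun x => (x, c)) f); last exact: cf.
by apply: continuous_pair => // y; [exact: cvg_id|exact: cvg_cst].
Qed.

Lemma continuous_slice_y (f : R * R -> R) (c : R) :
  continuous f -> continuous (fun x => f (c, x)).
Proof.
move=> cf x; apply: (@continuous_comp _ _ _ (fun x => (c, x)) f); last exact: cf.
by apply: continuous_pair => // y; [exact: cvg_cst|exact: cvg_id].
Qed.

(** On the parallel of colatitude t, of radius a = sin t, put x = a cos u on each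
    of the half-circles y > 0 and y < 0. The factor y^2 cancels the singularity
    of du = - dx / y at the ends of the diameter. *)
Lemma latitude_integral (k : R * R * R -> R) (t : R) :
  continuous k -> (forall v, 0 <= k v) -> 0 <= t <= pi ->
  (\int[mu]_(u in `[0%R, (2 * pi)%R])
     ((sin t * sin u) ^+ 2 * k (sin t * cos u, sin t * sin u, cos t) * sin t)%:E =
   \int[mu]_(x in `[(-1)%R, 1%R]) (sheet_sum k (x, cos t) * sin t)%:E)%E.
Proof.
move=> ck k0 tpi.
have a0 : 0 <= sin t by exact: sin_ge0_pi.
set a := sin t in a0 *.
pose y (x : R) : R := Num.sqrt (1 - x ^+ 2 - cos t ^+ 2).
have cy : continuous y.
  exact: (@continuous_slice_x _ (cos t) sheet_height_continuous).
have yE u : y (a * cos u) = `|a * sin u|.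
  rewrite /y -sqrtr_sqr; congr Num.sqrt.
  by rewrite cos2sin2 -/a !exprMn (sin2cos2 u); ring.
(* e = 1 gives the half-circle y >= 0 and e = -1 the half-circle y <= 0 *)
have cF (e : R) : continuous (fun x => y x * k (x, e * y x, cos t) * a).
  move=> x; apply: cvgM; last exact: cvg_cst.
  apply: cvgM; first exact: cy.
  apply: (@continuous_comp _ _ _ (fun x => (x, e * y x, cos t)) k); last exact: ck.
  apply: continuous_pair; last by move=> ?; exact: cvg_cst.
  apply: continuous_pair => // z; first exact: cvg_id.
  by apply: cvgM; [exact: cvg_cst|exact: cy].
have p0 := pi_ge0 R.
rewrite (@integral_itv_cat _ _ 0 pi); last 4 first.
- move=> u; apply: cvgM; last exact: cvg_cst.
  apply: cvgM.
    apply: (@continuous_comp _ _ _ (fun u => a * sin u) (fun x : R => x ^+ 2));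
      last exact: sqr_continuous.
    by apply: cvgM; [exact: cvg_cst|exact: continuous_sin].
  apply: (@continuous_comp _ _ _ (fun u => (a * cos u, a * sin u, cos t)) k); last exact: ck.
  apply: continuous_pair; last by move=> ?; exact: cvg_cst.
  apply: continuous_pair => v; apply: cvgM;
    [exact: cvg_cst|exact: continuous_cos|exact: cvg_cst|exact: continuous_sin].
- by move=> u; rewrite mulr_ge0// mulr_ge0// sqr_ge0.
- by [].
- by lra.
transitivity (\int[mu]_(x in `[(- a)%R, a]) (y x * k (x, 1 * y x, cos t) * a)%:E +
              \int[mu]_(x in `[(- a)%R, a]) (y x * k (x, -1 * y x, cos t) * a)%:E)%E.
  congr (_ + _)%E.
    rewrite (integral_cosine (cF 1) a0).1.
    apply: eq_integral => u; rewrite inE/= in_itv/= => u0.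
    have s0 : 0 <= a * sin u by rewrite mulr_ge0// sin_ge0_pi.
    by rewrite yE ger0_norm// mul1r; congr EFin; ring.
  rewrite (integral_cosine (cF (-1)) a0).2.
  apply: eq_integral => u; rewrite inE/= in_itv/= => /andP[u0 u1].
  have s0 : a * sin u <= 0.
    rewrite mulr_ge0_le0// -[u](subrK pi) sinDpi oppr_le0 sin_ge0_pi//; lra.
  by rewrite yE ler0_norm// mulN1r opprK; congr EFin; ring.
rewrite -ge0_integralD//; last 4 first.
- by move=> x _; rewrite lee_fin !mulr_ge0// sqrtr_ge0.
- exact: continuous_EFin_measurable.
- by move=> x _; rewrite lee_fin !mulr_ge0// sqrtr_ge0.
- exact: continuous_EFin_measurable.
rewrite integral_mkcond [RHS]integral_mkcond; apply: eq_integral => x _.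
rewrite !patchE !mem_setE !in_itv/=.
have -> : (y x * k (x, 1 * y x, cos t) * a)%:E + (y x * k (x, -1 * y x, cos t) * a)%:E =
    (sheet_sum k (x, cos t) * a)%:E.
  by rewrite -EFinD mul1r mulN1r /sheet_sum /= -/(y x); congr EFin; ring.
have a1 : a <= 1 by exact: sin_le1.
case: ifPn => xa; case: ifPn => x1 //.
  by move: x1; rewrite (le_trans _ (andP xa).1) ?lerN2// (le_trans (andP xa).2).
rewrite /sheet_sum /= (_ : Num.sqrt _ = 0) ?mul0r// ler0_sqrtr// cos2sin2 -/a.
have : a ^+ 2 <= x ^+ 2.
  rewrite -(ger0_norm a0) -real_normK ?num_real// -(real_normK (num_real x)).
  rewrite ler_pXn2r// ?nnegrE// ltW// ltNge; apply/negP.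
  rewrite normr_id (ger0_norm a0) ler_norml => xx.
  by rewrite xx in xa.
by lra.
Qed.

(** After [latitude_integral], substitute z = cos t in the outer integral. That
    is done for fixed x, where the density is a continuous function of z, so the
    order of integration is exchanged first. *)
Lemma sphere_integral_sheets (k : R * R * R -> R) : admissible k ->
  sphere_integral (fun v : R * R * R => v.1.2 ^+ 2 * k v) =
  (\int[(mu \x mu)%E]_(p in (`[(-1)%R, 1%R] `*` `[(-1)%R, 1%R])) (sheet_sum k p)%:E)%E.
Proof.
move=> ak; have [ck mk k0] := ak.
rewrite sphere_integralE; last first.
  apply: admissible_tame.
    apply: tameM; last exact: tame_admissible.
    by apply: (tame_comp sqr_continuous); exact: tame_y.
  by move=> v; rewrite mulr_ge0 ?sqr_ge0.
transitivity (\int[mu]_(t in `[0%R, pi]) \int[mu]_(x in `[(-1)%R, 1%R])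
   (sheet_sum k (x, cos t) * sin t)%:E)%E.
  apply: eq_integral => t; rewrite inE/= in_itv/= => t0.
  exact: latitude_integral.
pose g (p : M * M) : \bar R := (sheet_sum k (p.2, cos p.1) * sin p.1)%:E.
have mg : measurable_fun [set: (M * M)%type] g.
  have ms : measurable_fun [set: (M * M)%type] (fun p : M * M => sin p.1 : R).
    apply: (measurableT_comp _ measurable_fst).
    by apply: continuous_measurable_fun; exact: continuous_sin.
  have mc : measurable_fun [set: (M * M)%type] (fun p : M * M => cos p.1 : M).
    apply: (measurableT_comp _ measurable_fst).
    by apply: continuous_measurable_fun; exact: continuous_cos.
  apply/measurable_EFinP; apply: measurable_funM => //.
  apply: (measurableT_comp (measurable_sheet_sum (tame_admissible ak))).
  by apply: measurable_fun_pair => //; exact: measurable_snd.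
have g0 x y : `[0%R, pi]%classic x -> `[(-1)%R, 1%R]%classic y -> (0 <= g (x, y))%E.
  by rewrite /= in_itv/= => x0 _; rewrite lee_fin mulr_ge0 ?sheet_sum_ge0// sin_ge0_pi.
have [g1 g2] := tonelli_rect mu mu (measurable_itv `[0%R, pi])
  (measurable_itv `[(-1)%R, 1%R]) mg g0.
rewrite -[LHS]g1 g2.
have mh : measurable_fun [set: (M * M)%type] (fun p : M * M => (sheet_sum k p)%:E).
  by apply/measurable_EFinP; exact: measurable_sheet_sum (tame_admissible ak).
rewrite (tonelli_rect mu mu (measurable_itv _) (measurable_itv _) mh _).1; last first.
  by move=> x y _ _; rewrite lee_fin sheet_sum_ge0.
apply: eq_integral => x _.
have ch : continuous (fun z => sheet_sum k (x, z)).
  by apply: continuous_slice_y; exact: sheet_sum_continuous.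
rewrite (integral_cosine ch ler01).1; apply: eq_integral => t _.
by rewrite /g /= !mul1r.
Qed.

Definition swap_xz (v : R * R * R) : R * R * R := (v.2, v.1.2, v.1.1).

Lemma admissible_swap_xz k : admissible k -> admissible (k \o swap_xz).
Proof.
move=> ak; apply: admissible_tame; last by case: ak => _ _ k0 v; exact: k0.
by apply: tame_subst; [exact: tame_admissible|exact: tame_z|exact: tame_y|exact: tame_x].
Qed.

Lemma sphere_integral_swap_sqr_y k : admissible k ->
  sphere_integral (fun v : R * R * R => v.1.2 ^+ 2 * k (swap_xz v)) =
  sphere_integral (fun v : R * R * R => v.1.2 ^+ 2 * k v).
Proof.
move=> ak; rewrite (sphere_integral_sheets (admissible_swap_xz ak)) sphere_integral_sheets//.
have m k' : admissible k' ->
    measurable_fun [set: (M * M)%type] (fun p : M * M => (sheet_sum k' p)%:E).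
  by move=> ak'; apply/measurable_EFinP; exact: measurable_sheet_sum (tame_admissible ak').
have k0 (k' : R * R * R -> R) : admissible k' -> forall x y,
    `[(-1)%R, 1%R]%classic x -> `[(-1)%R, 1%R]%classic y ->
    (0 <= (sheet_sum k' (x, y))%:E)%E.
  by move=> [_ _ k0] x y _ _; rewrite lee_fin sheet_sum_ge0.
have as_ := admissible_swap_xz ak.
rewrite (tonelli_rect mu mu (measurable_itv _) (measurable_itv _) (m _ as_) (k0 _ as_)).1.
rewrite (tonelli_rect mu mu (measurable_itv _) (measurable_itv _) (m _ ak) (k0 _ ak)).2.
apply: eq_integral => x _; apply: eq_integral => y _.
by rewrite /sheet_sum /swap_xz /= addrAC.
Qed.

(** The parameters of the points with y = 0. *)
Definition polar_seam : set (M * M) := [set p | sin p.1 = 0 \/ sin p.2 = 0].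

Lemma measurable_polar_seam : measurable polar_seam.
Proof.
have ms : measurable_fun [set: R] (@sin R).
  by apply: continuous_measurable_fun; exact: continuous_sin.
have m1 : measurable_fun [set: (M * M)%type] (fun p : M * M => sin p.1 : R).
  exact: (measurableT_comp ms measurable_fst).
have m2 : measurable_fun [set: (M * M)%type] (fun p : M * M => sin p.2 : R).
  exact: (measurableT_comp ms measurable_snd).
have -> : polar_seam =
    ((fun p : M * M => sin p.1 : R) @^-1` [set 0]) `|`
    ((fun p : M * M => sin p.2 : R) @^-1` [set 0]) by [].
by apply: measurableU; rewrite -[X in measurable X]setTI;
  [apply: m1|apply: m2] => //; exact: measurable_set1.
Qed.

Lemma sin_eq0_0pi (t : R) : 0 <= t <= pi -> sin t = 0 -> t = 0 \/ t = pi.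
Proof.
move=> /andP[]; rewrite le_eqVlt => /predU1P[<-|t0]; first by left.
rewrite le_eqVlt => /predU1P[<-|tpi]; first by right.
by move=> s0; have := @sin_gt0_pi R t; rewrite t0 tpi s0 ltxx => /(_ isT).
Qed.

Lemma sin_eq0_02pi (t : R) : 0 <= t <= 2 * pi -> sin t = 0 ->
  [\/ t = 0, t = pi | t = 2 * pi].
Proof.
move=> /andP[t0 t2] st; case: (leP t pi) => tpi.
  by have [] := @sin_eq0_0pi t _ st; rewrite ?t0//; [constructor 1|constructor 2].
have [||/eqP|] := @sin_eq0_0pi (t - pi).
- by apply/andP; split; lra.
- by have := sinDpi (t - pi); rewrite subrK st => /esym/eqP; rewrite oppr_eq0 => /eqP.
- by rewrite subr_eq0 => /eqP ->; constructor 2.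
- by move=> e; constructor 3; lra.
Qed.

Lemma sphere_integral_off_seam (f : R * R * R -> R) : admissible f ->
  sphere_integral f = (\int[(mu \x mu)%E]_(p in @coordinates_domain R `\` polar_seam)
    (f (sphere_point p) * sin p.1)%:E)%E.
Proof.
move=> af.
pose A : set M := [set 0] `|` [set pi].
pose B : set M := [set 0] `|` [set pi] `|` [set 2 * pi].
have mA : measurable A by apply: measurableU; exact: measurable_set1.
have mB : measurable B by apply: measurableU => //; exact: measurable_set1.
have A0 : mu A = 0%E.
  by rewrite measureU0//= ?lebesgue_measure_set1//; exact: measurable_set1.
have B0 : mu B = 0%E.
  by rewrite measureU0//= ?lebesgue_measure_set1//; exact: measurable_set1.
pose N : set (M * M) := (A `*` setT) `|` (setT `*` B).
have mAT : measurable (A `*` [set: M]) by exact: measurableX.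
have mTB : measurable ([set: M] `*` B) by exact: measurableX.
have mN : measurable N by exact: measurableU.
have N0 : (mu \x mu)%E N = 0%E.
  rewrite measureU0//= product_measure1E//=.
    by rewrite A0 mul0e.
  by rewrite B0 mule0.
have mD : measurable (@coordinates_domain R : set (M * M)).
  by apply: measurableX; exact: measurable_itv.
have mf := measurable_sphere_integrand af.
rewrite /sphere_integral (ge0_negligible_integral mN mD _ _ N0); last 2 first.
- exact: measurable_funTS.
- move=> [t u] [/= + _]; rewrite in_itv/= => t0; rewrite lee_fin mulr_ge0// ?sin_ge0_pi//.
  by case: af.
congr (integral _ _ _).
apply/seteqP; split => -[t u] [/= [+ +]]; rewrite /= !in_itv/= => t0 u0 h;
  split => //=; rewrite ?in_itv//=; apply: contra_not h.
- case.
    by case/(sin_eq0_0pi t0) => ->; left; split => //; [left|right].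
  by case/(sin_eq0_02pi u0) => ->; right; split => //; [left;left|left;right|right].
- have s2 : sin (2 * pi) = 0 :> R by rewrite mulr_natl sin2pi.
  case=> /= -[]; first by move=> [] -> _; left; rewrite ?sin0 ?sinpi.
  by move=> _ [[]|] ->; right; rewrite ?sin0 ?sinpi ?s2.
Qed.

(** The quotient by y^2, with the denominator bounded away from 0: the functions
    y^2 * cutoff n f increase to f wherever y <> 0. *)
Definition cutoff n (f : R * R * R -> R) (v : R * R * R) : R :=
  f v / Num.max (v.1.2 ^+ 2) n.+1%:R^-1.

Lemma admissible_cutoff n f : admissible f -> admissible (cutoff n f).
Proof.
move=> af; have p0 (v : R * R * R) : 0 < Num.max (v.1.2 ^+ 2) n.+1%:R^-1.
  by rewrite lt_max invr_gt0 ltr0Sn orbT.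
apply: admissible_tame; last by case: af => _ _ f0 v; rewrite divr_ge0// ltW.
apply: tameM; first exact: tame_admissible.
apply: (@tame_comp _ (fun y : R => (Num.max (y ^+ 2) n.+1%:R^-1)^-1)); last exact: tame_y.
move=> y; apply: cvgV; first by rewrite gt_eqF// lt_max invr_gt0 ltr0Sn orbT.
exact: (continuous_max (@sqr_continuous y) (cvg_cst _)).
Qed.

Lemma sphere_integral_cutoff f : admissible f ->
  sphere_integral (fun v : R * R * R => v.1.2 ^+ 2 * cutoff n f v) @[n --> \oo]
    --> sphere_integral f.
Proof.
move=> af; have [_ _ f0] := af.
have ag n : admissible (fun v : R * R * R => v.1.2 ^+ 2 * cutoff n f v).
  have ac := admissible_cutoff n af.
  apply: admissible_tame; last by case: ac => _ _ c0 v; rewrite mulr_ge0// sqr_ge0.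
  apply: tameM; last exact: tame_admissible.
  by apply: (tame_comp sqr_continuous); exact: tame_y.
rewrite sphere_integral_off_seam//.
under eq_fun do rewrite sphere_integral_off_seam//.
have D0 : forall p : R * R, (@coordinates_domain R `\` polar_seam) p ->
    0 < sin p.1 /\ sin p.2 != 0.
  move=> [t u] [/= [+ _]]; rewrite /= in_itv/= => t0 h.
  split; last by apply/eqP => ?; apply: h; right.
  rewrite lt_neqAle sin_ge0_pi// andbT; apply/eqP => s0; apply: h; left; exact/esym.
set S := _ `\` polar_seam.
have -> : (\int[(mu \x mu)%E]_(p in S) (f (sphere_point p) * sin p.1)%:E =
   \int[(mu \x mu)%E]_(p in S)
     limn (fun n =>
       ((sphere_point p).1.2 ^+ 2 * cutoff n f (sphere_point p) * sin p.1)%:E))%E.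
  apply: eq_integral => p; rewrite inE => /D0[s0 u0].
  apply/esym/cvg_lim => //.
  have y0 : 0 < (sphere_point p).1.2 ^+ 2.
    by rewrite exprn_even_gt0//= mulf_neq0// gt_eqF.
  apply: cvg_near_cst.
  apply: filterS (near_infty_natSinv_lt (PosNum y0)) => n /= /ltW ny.
  congr (EFin (_ * _)).
  by rewrite /cutoff max_l//= mulrCA divff ?mulr1// gt_eqF.
apply: cvg_monotone_convergence.
- apply: measurableD; last exact: measurable_polar_seam.
  by apply: measurableX; exact: measurable_itv.
- by move=> n; exact: (measurable_funTS (measurable_sphere_integrand (ag n))).
- move=> n p /D0[s0 _]; rewrite lee_fin mulr_ge0//; last exact: ltW.
  by have [_ _] := ag n; exact.
- move=> p /D0[s0 _] m n mn; rewrite lee_fin ler_pM2r//.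
  rewrite ler_wpM2l ?sqr_ge0// ler_wpM2l//.
  rewrite lef_pV2 ?posrE ?lt_max ?invr_gt0 ?ltr0Sn ?orbT//.
  by rewrite ge_max le_max lexx /= le_max lef_pV2 ?posrE ?ltr0Sn// ler_nat ltnS mn orbT.
Qed.

(** The factor y^2 commutes with the exchange, so the two sides are limits of the
    same sequence. *)
Lemma sphere_integral_swap f : admissible f ->
  sphere_integral (f \o swap_xz) = sphere_integral f.
Proof.
move=> af; have as_ := admissible_swap_xz af.
have c1 := sphere_integral_cutoff af.
have c2 := sphere_integral_cutoff as_.
have e :
    (fun n => sphere_integral (fun v : R * R * R => v.1.2 ^+ 2 * cutoff n (f \o swap_xz) v)) =
    (fun n => sphere_integral (fun v : R * R * R => v.1.2 ^+ 2 * cutoff n f v)).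
  by apply/funext => n; rewrite -(sphere_integral_swap_sqr_y (admissible_cutoff n af)).
rewrite e in c2.
exact: (cvg_unique _ c2 c1).
Qed.

End CoordinateExchange.

(** * Moving two unit vectors onto the equator *)

Section CanonicalPosition.
Variable R : realType.
Local Notation vec := (R * R * R)%type.

Definition dot (a v : vec) : R := a.1.1 * v.1.1 + a.1.2 * v.1.2 + a.2 * v.2.

Lemma dot_rotz c a b : dot (rotz c a) (rotz c b) = dot a b.
Proof.
rewrite /dot /rotz /=; have := cos2Dsin2 c; move: (cos c) (sin c) => x y xy.
transitivity ((x ^+ 2 + y ^+ 2) * (a.1.1 * b.1.1 + a.1.2 * b.1.2) + a.2 * b.2).
  by ring.
by rewrite xy mul1r.
Qed.

Lemma dot_swap a b : dot (swap_xz a) (swap_xz b) = dot a b.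
Proof. by rewrite /dot /swap_xz /=; ring. Qed.

(** The angle is acos (x / r), with the sign opposite to that of y. *)
Lemma rotz_to_axis (x y z : R) : exists2 c, `|c| <= 2 * pi &
  rotz c (x, y, z) = (Num.sqrt (x ^+ 2 + y ^+ 2), 0, z).
Proof.
have p0 := pi_ge0 R.
set r := Num.sqrt _; have rE : r ^+ 2 = x ^+ 2 + y ^+ 2.
  by rewrite sqr_sqrtr// addr_ge0 ?sqr_ge0.
have : 0 <= r by exact: sqrtr_ge0.
rewrite le_eqVlt => /predU1P[r0|r0].
  have x0 : x = 0.
    apply/eqP; rewrite -sqrf_eq0; apply/eqP.
    by move: rE; rewrite -r0 expr0n /= => h; have := sqr_ge0 x; have := sqr_ge0 y; lra.
  have y0 : y = 0.
    apply/eqP; rewrite -sqrf_eq0; apply/eqP.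
    by move: rE; rewrite -r0 expr0n /= => h; have := sqr_ge0 x; have := sqr_ge0 y; lra.
  exists 0; first by rewrite normr0 mulr_ge0.
  by rewrite /rotz /= cos0 sin0 -r0 x0 y0; congr (_, _, _); ring.
have x1 : -1 <= x / r <= 1.
  rewrite -ler_norml -(@ler_pXn2r _ 2)// ?nnegrE// expr1n real_normK ?num_real//.
  by rewrite exprMn exprVn ler_pdivrMr ?exprn_gt0// mul1r rE; have := sqr_ge0 y; lra.
have sE : sin (acos (x / r)) = `|y| / r.
  rewrite sin_acos// -[in RHS](ger0_norm (ltW r0)) -normf_div -sqrtr_sqr; congr Num.sqrt.
  by rewrite !exprMn !exprVn rE; field; rewrite -rE expf_neq0// gt_eqF.
have cE : cos (acos (x / r)) = x / r by rewrite acosK// in_itv.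
have rn : r != 0 by rewrite gt_eqF.
have b0 := acos_ge0 x1; have b1 := acos_lepi x1.
have fin (c : R) : cos c = x / r -> sin c = - (y / r) -> rotz c (x, y, z) = (r, 0, z).
  move=> cc sc; rewrite /rotz /= cc sc; congr (_, _, _); last by field.
  transitivity ((x ^+ 2 + y ^+ 2) / r); first by field.
  by rewrite -rE; field.
case: (leP 0 y) => y0.
  exists (- acos (x / r)); first by rewrite normrN ger0_norm//; lra.
  by apply: fin; rewrite ?cosN ?sinN// sE ger0_norm.
exists (acos (x / r)); first by rewrite ger0_norm//; lra.
by apply: fin => //; rewrite sE ltr0_norm// mulNr.
Qed.

Lemma rotz_pihalf (x y z : R) : rotz (pi / 2) (x, y, z) = (- y, x, z).
Proof. by rewrite /rotz /= cos_pihalf sin_pihalf; congr (_, _, _); ring. Qed.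

Lemma swapE (x y z : R) : swap_xz (x, y, z) = (z, y, x). Proof. by []. Qed.

(** Rotations about the third axis and the exchange of the first and third
    coordinates generate the orthogonal group. It suffices to follow the two
    vectors, so P stands for any property of pairs invariant under these maps. *)
Section canonical_position.
Variable P : vec -> vec -> Prop.
Hypothesis P_rotz : forall c a b, `|c| <= 2 * pi -> P (rotz c a) (rotz c b) -> P a b.
Hypothesis P_swap : forall a b, P (swap_xz a) (swap_xz b) -> P a b.

Let pihalf_le : `|pi / 2| <= 2 * pi :> R.
Proof. by have := pi_ge0 R => p0; rewrite ger0_norm; lra. Qed.

Lemma move_to_x_axis a b : dot a a = 1 -> exists b',
  [/\ dot b' b' = dot b b, dot (1, 0, 0) b' = dot a b & P (1, 0, 0) b' -> P a b].
Proof.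
case: a => -[a1 a2] a3 a_unit.
have [c1 c1pi e1] := rotz_to_axis a1 a2 a3.
set r := Num.sqrt _ in e1.
have r2 : r ^+ 2 = a1 ^+ 2 + a2 ^+ 2 by rewrite sqr_sqrtr// addr_ge0 ?sqr_ge0.
(* The quarter-turn between two exchanges carries the third coordinate into
   the second place, so that another rotation about the third axis can absorb it. *)
have [c2 c2pi e2] := rotz_to_axis r a3 0.
rewrite r2 in e2.
have e3 : Num.sqrt (a1 ^+ 2 + a2 ^+ 2 + a3 ^+ 2) = 1.
  by rewrite -[RHS]sqrtr1 -a_unit /dot /=.
rewrite e3 in e2.
pose T v := rotz c2 (swap_xz (rotz (pi / 2) (swap_xz (rotz c1 v)))).
have Ta : T (a1, a2, a3) = (1, 0, 0).
  by rewrite /T e1 (swapE r) rotz_pihalf oppr0 swapE e2.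
exists (T b); split.
- by rewrite /T !(dot_rotz, dot_swap).
- by rewrite -Ta /T !(dot_rotz, dot_swap).
- rewrite -Ta /T => h; apply: (P_rotz c1pi); apply: P_swap; apply: (P_rotz pihalf_le).
  by apply: P_swap; exact: (P_rotz c2pi).
Qed.

(** With a on the first axis, turn b about that axis into the equator, on the
    side of nonnegative second coordinate. Then b has longitude
    acos (dot a b) = 2 d, and a rotation by - d puts the two points
    symmetrically. *)
Lemma canonical_position a b : dot a a = 1 -> dot b b = 1 ->
  let d := acos (dot a b) / 2 in
  P (cos d, - sin d, 0) (cos d, sin d, 0) -> P a b.
Proof.
move=> a1 b1 d Pd; have [b' [bb ab]] := move_to_x_axis b a1; apply.
case: b' bb ab => -[x y] z; rewrite /dot /= => bb ab.
have [c cpi e] := rotz_to_axis z y x.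
set s := Num.sqrt _ in e.
have xE : x = dot a b by rewrite /dot -ab; ring.
have x1 : -1 <= x <= 1.
  rewrite -ler_norml -(@ler_pXn2r _ 2)// ?nnegrE// expr1n real_normK ?num_real//.
  have := b1; rewrite /dot -bb; have := sqr_ge0 y; have := sqr_ge0 z; rewrite !expr2; lra.
have sE : s = sin (2 * d).
  rewrite /d mulrC divfK// -xE sin_acos//; congr Num.sqrt.
  have := b1; rewrite /dot -bb !expr2; lra.
have cE : x = cos (2 * d) by rewrite /d mulrC divfK// -xE acosK// in_itv.
have d0 : 0 <= d by rewrite divr_ge0// -xE acos_ge0.
have dpi : d <= 2 * pi.
  by have := acos_lepi x1; rewrite xE => ?; have := pi_ge0 R; rewrite /d; lra.
apply: P_swap; rewrite /swap_xz /=; apply: (P_rotz cpi).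
rewrite e /rotz /= !mulr0 subrr addr0; apply: (P_rotz pihalf_le).
rewrite !rotz_pihalf oppr0; apply: P_swap; rewrite /swap_xz /=.
apply: (@P_rotz (- d)); first by rewrite normrN ger0_norm.
rewrite /rotz /= cosN sinN sE cE.
have -> : cos d * 1 - - sin d * 0 = cos d by ring.
have -> : - sin d * 1 + cos d * 0 = - sin d by ring.
have -> : cos d * cos (2 * d) - - sin d * sin (2 * d) = cos d.
  by rewrite mulNr opprK (mulrC (cos d)) (mulrC (sin d)) -cosB; congr cos; ring.
have -> // : - sin d * cos (2 * d) + cos d * sin (2 * d) = sin d.
by rewrite addrC mulNr (mulrC (cos d)) (mulrC (sin d)) -sinB; congr sin; ring.
Qed.
End canonical_position.

End CanonicalPosition.

(** * Caps that contain one of two points *)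

Section ZonalBounds.
Variable R : realType.
Local Notation mu := (@lebesgue_measure R).
Local Notation vec := (R * R * R)%type.

Lemma tame_dot (a : vec) : tame (dot a).
Proof.
by apply: tameD; [apply: tameD|]; (apply: tameM; first exact: tame_cst);
  [exact: tame_x|exact: tame_y|exact: tame_z].
Qed.

Definition pair_integral (G : R -> R -> R) (a b : vec) : \bar R :=
  sphere_integral (fun v => G (dot a v) (dot b v)).

Lemma pair_integral_canonical (G : R -> R -> R) (a b : vec) :
  (forall f g, tame f -> tame g -> tame (fun v : vec => G (f v) (g v))) ->
  (forall s t, 0 <= G s t) ->
  dot a a = 1 -> dot b b = 1 ->
  let d := acos (dot a b) / 2 in
  pair_integral G a b = pair_integral G (cos d, - sin d, 0) (cos d, sin d, 0).
Proof.
move=> tG G0 a1 b1 d; set X := RHS.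
have adm a' b' : admissible (fun v : vec => G (dot a' v) (dot b' v)).
  by apply: admissible_tame => //; apply: tG; exact: tame_dot.
apply: (@canonical_position _ (fun a b => pair_integral G a b = X)) => //.
  move=> c a' b' cpi <-; rewrite /pair_integral.
  rewrite -(sphere_integral_rotz (adm (rotz c a') (rotz c b')) cpi).
  by congr sphere_integral; apply/funext => v /=; rewrite !dot_rotz.
move=> a' b' <-; rewrite /pair_integral.
rewrite -(sphere_integral_swap (adm (swap_xz a') (swap_xz b'))).
by congr sphere_integral; apply/funext => v /=; rewrite !dot_swap.
Qed.

Lemma integral_sin (a b : R) : a < b ->
  (\int[mu]_(t in `[a, b]) (sin t)%:E = (cos a - cos b)%:E)%E.
Proof.
move=> ab.
have d (x : R) : is_derive x (1 : R) (- @cos R) (sin x).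
  by apply: is_derive_eq; rewrite opprK.
rewrite (@continuous_FTC2 _ _ (- @cos R))//.
- by rewrite -EFinB /= !fctE opprK addrC.
- exact/continuous_subspaceT/continuous_sin.
- split.
  + by move=> x _; apply: ex_derive.
  + by apply: cvg_at_right_filter; apply: cvgN; exact: continuous_cos.
  + by apply: cvg_at_left_filter; apply: cvgN; exact: continuous_cos.
- by move=> x _; rewrite derive1E derive_val.
Qed.

Lemma integral_le_length (F : R -> R) (a b : R) :
  continuous F -> (forall x, 0 <= F x <= 1) -> a <= b ->
  (\int[mu]_(x in `[a, b]) (F x)%:E <= (b - a)%:E)%E.
Proof.
move=> cF F01 ab.
have -> : (b - a)%:E = (\int[mu]_(x in `[a, b]) (cst 1%E x))%E.
  rewrite integral_cst//= mul1e lebesgue_measure_itv/= lte_fin.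
  by case: ltP => // ba; rewrite (@le_anti _ _ a b) ?ab// subrr.
apply: ge0_le_integral_any => x; rewrite !patchE; case: ifPn => _.
  by rewrite !lee_fin.
by rewrite lexx.
Qed.

(** When F (. + d) and F (. - d) are comparable on [a, b], the absolute value
    can be dropped; the two integrals then range over windows that differ by an
    interval of length 2 d at each end, and 0 <= F <= 1. *)
Lemma integral_shift_diff (F : R -> R) (a b d : R) :
  continuous F -> (forall x, 0 <= F x <= 1) -> a <= b -> 0 <= d ->
  (forall u, a <= u <= b -> F (u + d) <= F (u - d)) \/
  (forall u, a <= u <= b -> F (u - d) <= F (u + d)) ->
  (\int[mu]_(u in `[a, b]) `|F (u + d) - F (u - d)|%:E <= (2 * d)%:E)%E.
Proof.
move=> cF F01 ab d0 mono.
have F0 x : 0 <= F x by have /andP[] := F01 x.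
have cs (e : R) : continuous (fun u => F (u + e)).
  move=> u; apply: continuous_comp; last exact: cF.
  by apply: cvgD; [exact: cvg_id|exact: cvg_cst].
have fin (e : R) : (\int[mu]_(u in `[a, b]) (F (u + e))%:E \is a fin_num)%E.
  rewrite ge0_fin_numE; last by apply: integral_ge0 => u _; rewrite lee_fin.
  rewrite (integral_shift _ cF ab).
  by apply: le_lt_trans (integral_le_length cF F01 _) _; rewrite ?ltry// lerD2r.
have cat (p q r : R) : p <= q -> q <= r -> (\int[mu]_(u in `[p, r]) (F u)%:E =
  \int[mu]_(u in `[p, q]) (F u)%:E + \int[mu]_(u in `[q, r]) (F u)%:E)%E.
  exact: integral_itv_cat.
have sub (p q r s : R) : p <= q -> r <= s ->
   (\int[mu]_(u in `[q, r]) (F u)%:E <= \int[mu]_(u in `[p, s]) (F u)%:E)%E.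
  move=> pq rs; apply: ge0_le_integral_any => x; rewrite !patchE !mem_setE !in_itv/=.
  case: ifPn => [/andP[qx xr]|_]; last by case: ifPn => _; rewrite ?lexx ?lee_fin ?lexx ?F0.
  by rewrite (le_trans pq qx) (le_trans xr rs) !lee_fin lexx F0.
have step (e : R) : (e = d \/ e = - d) ->
    (forall u, a <= u <= b -> F (u + e) <= F (u - e)) ->
    (\int[mu]_(u in `[a, b]) (F (u - e) - F (u + e))%:E <= (2 * d)%:E)%E.
  move=> ed mon.
  rewrite -(leeD2rE _ _ (fin e)) -ge0_integralD//; last 4 first.
  - by move=> u; rewrite /= in_itv/= => uab; rewrite lee_fin subr_ge0 mon.
  - by apply: continuous_EFin_measurable => u; apply: cvgB; exact: cs.
  - by move=> u _; rewrite lee_fin.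
  - by apply: continuous_EFin_measurable; exact: cs.
  under eq_integral do rewrite -EFinD subrK.
  rewrite (@integral_shift _ F a b (- e))// (@integral_shift _ F a b e)//.
  have len (p : R) : (\int[mu]_(u in `[(p - d)%R, (p + d)%R]) (F u)%:E <= (2 * d)%:E)%E.
    apply: le_trans (integral_le_length cF F01 _) _; first by lra.
    by rewrite lee_fin; lra.
  case: ed => ->.
    apply: (@le_trans _ _ (\int[mu]_(u in `[(a - d)%R, (b + d)%R]) (F u)%:E)%E).
      by apply: sub; lra.
    by rewrite (cat _ (a + d)); [|lra|lra]; apply: leeD.
  rewrite opprK.
  apply: (@le_trans _ _ (\int[mu]_(u in `[(a - d)%R, (b + d)%R]) (F u)%:E)%E).
    by apply: sub; lra.
  by rewrite (cat _ (b - d)) 1?addeC; [|lra|lra]; apply: leeD.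
case: mono => mon.
  apply: le_trans (step d _ mon); last by left.
  rewrite le_eqVlt; apply/orP; left; apply/eqP; apply: eq_integral => u.
  rewrite inE/= in_itv/= => uab.
  by rewrite distrC ger0_norm// subr_ge0 mon.
apply: le_trans (step (- d) _ _); [|by right|by move=> u; rewrite opprK; exact: mon].
rewrite le_eqVlt; apply/orP; left; apply/eqP; apply: eq_integral => u.
rewrite inE/= in_itv/= => uab.
by rewrite opprK ger0_norm// subr_ge0 mon.
Qed.

(** A continuous substitute for the indicator function of the half-line t > c. *)
Definition soft_step (h : R -> R) (c : R) :=
  [/\ continuous h, {homo h : x y / x <= y}, forall x, 0 <= h x <= 1
    & forall x, x <= c -> h x = 0].

Lemma sqnorm_sphere_point p : dot (sphere_point p) (sphere_point p) = 1 :> R.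
Proof.
rewrite /dot /sphere_point /=.
transitivity (sin p.1 ^+ 2 * (cos p.2 ^+ 2 + sin p.2 ^+ 2) + cos p.1 ^+ 2); first by ring.
by rewrite cos2Dsin2 mulr1 addrC cos2Dsin2.
Qed.

Lemma dot_unit_itv (a b : vec) : dot a a = 1 -> dot b b = 1 -> -1 <= dot a b <= 1.
Proof.
rewrite /dot => a1 b1.
have := sqr_ge0 (a.1.1 - b.1.1); have := sqr_ge0 (a.1.2 - b.1.2); have := sqr_ge0 (a.2 - b.2).
have := sqr_ge0 (a.1.1 + b.1.1); have := sqr_ge0 (a.1.2 + b.1.2); have := sqr_ge0 (a.2 + b.2).
rewrite !expr2 => *; apply/andP; split; lra.
Qed.

(** On the parallel of colatitude t the two points at longitudes -d and d of the
    equator have inner products sin t cos (u + d) and sin t cos (u - d) with the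
    point of longitude u. Which one is larger depends on the sign of sin u only,
    so each half of the parallel contributes at most 2 d. *)
Lemma parallel_diff_bound h (t d c : R) : soft_step h c -> 0 <= t <= pi -> 0 <= d <= pi / 2 ->
  (\int[mu]_(u in `[0%R, (2 * pi)%R])
      (`|h (sin t * cos (u + d)) - h (sin t * cos (u - d))| * sin t)%:E
   <= (if c < sin t then 4 * d * sin t else 0)%:E)%E.
Proof.
move=> [ch mh h01 h0] tpi dpi.
have p0 := pi_ge0 R.
have s0 : 0 <= sin t by exact: sin_ge0_pi.
have sd : 0 <= sin d by apply: sin_ge0_pi; lra.
case: ltP => [_|tc]; last first.
  rewrite integral0_eq// => u _; rewrite !h0 ?subrr ?normr0 ?mul0r//.
    by apply: le_trans tc; rewrite ler_piMr// cos_le1.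
  by apply: le_trans tc; rewrite ler_piMr// cos_le1.
pose F u := h (sin t * cos u).
have cF : continuous F.
  move=> u; apply: (@continuous_comp _ _ _ (fun u => sin t * cos u) h); last exact: ch.
  by apply: cvgM; [exact: cvg_cst|exact: continuous_cos].
have cabs : continuous (fun u => `|F (u + d) - F (u - d)|).
  move=> u; apply: cvg_norm; apply: cvgB;
    apply: (@continuous_comp _ _ _ (fun u : R => u + _) F); try exact: cF;
    by apply: cvgD; [exact: cvg_id|exact: cvg_cst].
under eq_integral do rewrite mulrC EFinM.
rewrite ge0_integralZl_EFin//; last first.
  exact: (@continuous_EFin_measurable _ (fun u => `|F (u + d) - F (u - d)|) _ cabs).
rewrite [(4 * d * _)]mulrC EFinM lee_wpmul2l// ?lee_fin//.
have cosdiff u : cos (u - d) - cos (u + d) = 2 * (sin u * sin d) by rewrite cosB cosD; ring.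
rewrite (@integral_itv_cat _ (fun u => `|F (u + d) - F (u - d)|) 0 pi)//; last by lra.
have -> : 4 * d = 2 * d + 2 * d by ring.
rewrite EFinD; apply: leeD; apply: integral_shift_diff => //; try lra.
- by move=> x; exact: h01.
- left => u uab; apply: mh; rewrite ler_wpM2l// -subr_ge0 cosdiff mulr_ge0// mulr_ge0//.
  exact: sin_ge0_pi.
- by move=> x; exact: h01.
- right => u uab; apply: mh; rewrite ler_wpM2l// -subr_ge0 -opprB cosdiff oppr_ge0.
  rewrite mulr_ge0_le0// mulr_le0_ge0// -[u](subrK pi) sinDpi oppr_le0 sin_ge0_pi//; lra.
Qed.

(** The integral is the area, smoothed by h, of the centres whose circle of
    radius theta separates a from b. Only the parallels with sin t > cos theta,
    that is |t - pi/2| < theta, contribute. *)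
Lemma crofton_bound h (theta : R) (a b : vec) : soft_step h (cos theta) ->
  0 < theta < pi / 2 -> dot a a = 1 -> dot b b = 1 ->
  (pair_integral (fun s t => (`|h s - h t|)%R) a b <= (4 * acos (dot a b) * sin theta)%:E)%E.
Proof.
move=> hs th a1 b1; have [ch mh h01 h0] := hs.
have p0 := pi_ge0 R.
have tG (f g : vec -> R) : tame f -> tame g -> tame (fun v : vec => `|h (f v) - h (g v)|).
  move=> tf tg; apply: (@tame_comp _ (fun x => `|x|)); first exact: norm_continuous.
  apply: tameD; first exact: tame_comp.
  by apply: (@tame_comp _ -%R); [exact: opp_continuous|exact: tame_comp].
rewrite pair_integral_canonical//; set d := acos _ / 2.
have ab := dot_unit_itv a1 b1.
have dpi : 0 <= d <= pi / 2.
  by have := acos_ge0 ab; have := acos_lepi ab; rewrite /d; lra.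
rewrite /pair_integral sphere_integralE; last first.
  by apply: admissible_tame => //; apply: tG; exact: tame_dot.
have -> : 4 * acos (dot a b) * sin theta = 8 * d * sin theta by rewrite /d; field.
apply: (@le_trans _ _ (\int[mu]_(t in `[(pi / 2 - theta)%R, (pi / 2 + theta)%R])
    ((4 * d)%:E * (sin t)%:E))%E).
  apply: ge0_le_integral_any => t; rewrite !patchE !mem_setE !in_itv/=.
  case: ifPn => [t0|tn]; last first.
    rewrite lexx /=; case: ifPn => // tE.
    rewrite -EFinM lee_fin mulr_ge0//; last by apply: sin_ge0_pi; lra.
    by lra.
  apply/andP; split.
    by apply: integral_ge0 => u _; rewrite lee_fin mulr_ge0// sin_ge0_pi.
  have := parallel_diff_bound hs t0 dpi.
  under eq_integral => u _.
    have e1 : sin t * cos (u + d) =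
        dot (cos d, - sin d, 0) (sin t * cos u, sin t * sin u, cos t).
      by rewrite cosD /dot /=; ring.
    have e2 : sin t * cos (u - d) =
        dot (cos d, sin d, 0) (sin t * cos u, sin t * sin u, cos t).
      by rewrite cosB /dot /=; ring.
    rewrite e1 e2; over.
  move=> /le_trans; apply; case: ltP => tc; last first.
    case: ifPn => // tE.
    rewrite -EFinM lee_fin mulr_ge0//; last by apply: sin_ge0_pi; lra.
    by lra.
  rewrite ifT ?EFinM//.
  have st : cos theta < cos (`|t - pi / 2|).
    by rewrite cos_norm cosBpihalf.
  have nt : `|t - pi / 2| <= pi by rewrite ler_norml; lra.
  rewrite ltr_cos ?in_itv/= ?normr_ge0// in st; last by lra.
  by move: st; rewrite ltr_norml; lra.
rewrite ge0_integralZl_EFin//; last 3 first.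
- by move=> t; rewrite /= in_itv/= => tE; rewrite lee_fin sin_ge0_pi//; lra.
- exact: (@continuous_EFin_measurable _ _ _ (@continuous_sin R)).
- by lra.
rewrite integral_sin; last by lra.
rewrite -EFinM lee_fin.
have -> : pi / 2 - theta = - (theta - pi / 2) by ring.
rewrite cosN cosBpihalf (addrC (pi / 2)) cosDpihalf; lra.
Qed.

(** Move a to the pole, where h (dot a .) depends on the colatitude only. *)
Lemma cap_bound h (r : R) (a : vec) : soft_step h (cos r) ->
  0 < r <= pi -> dot a a = 1 ->
  (sphere_integral (fun v => h (dot a v)) <= (2 * pi * (1 - cos r))%:E)%E.
Proof.
move=> [ch mh h01 h0] rpi a1.
have p0 := pi_ge0 R.
have hpos x : 0 <= h x by have /andP[] := h01 x.
have tG (f g : vec -> R) : tame f -> tame g -> tame (fun v : vec => h (f v)).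
  by move=> tf _; exact: tame_comp.
have := @pair_integral_canonical (fun s _ => h s) a a tG (fun s _ => hpos s) a1 a1.
rewrite /= a1 acos1 mul0r cos0 sin0 oppr0 => e.
rewrite -[X in (X <= _)%E]/(pair_integral (fun s _ => h s) a a) e {e}.
rewrite /pair_integral -sphere_integral_swap; last first.
  by apply: admissible_tame => //; apply: tame_comp => //; exact: tame_dot.
have -> : (fun v : vec => h (dot (1, 0, 0) v)) \o @swap_xz R = (fun v : vec => h v.2).
  by apply/funext => v; rewrite /dot /=; congr h; ring.
rewrite sphere_integralE; last first.
  by apply: admissible_tame => //; apply: tame_comp => //; exact: tame_z.
have cE t : (\int[mu]_(u in `[0%R, (2 * pi)%R]) (h (cos t) * sin t)%:E =
    (2 * pi * (h (cos t) * sin t))%:E)%E.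
  rewrite integral_cst//= lebesgue_measure_itv/= lte_fin mulr_gt0//; last exact: pi_gt0.
  by rewrite -EFinB subr0 -EFinM mulrC.
under eq_integral do rewrite /= cE.
apply: (@le_trans _ _ (\int[mu]_(t in `[0%R, r]) ((2 * pi)%:E * (sin t)%:E))%E).
  apply: ge0_le_integral_any => t; rewrite !patchE !mem_setE !in_itv/=.
  case: ifPn => [t0|tn]; last first.
    rewrite lexx /=; case: ifPn => // tE; rewrite -EFinM lee_fin mulr_ge0// ?mulr_ge0//.
    by apply: sin_ge0_pi; lra.
  have st : 0 <= sin t by exact: sin_ge0_pi.
  rewrite lee_fin !mulr_ge0//=.
  case: ifPn => [_|tr].
    by rewrite -EFinM lee_fin ler_wpM2l ?mulr_ge0// ler_piMl//; have /andP[] := h01 (cos t).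
  rewrite h0 ?mul0r ?mulr0// ltW// ltr_cos ?in_itv/=; [|lra|lra].
  by case/andP: t0 tr => -> _ /=; rewrite -ltNge.
rewrite ge0_integralZl_EFin//; last 3 first.
- by move=> t; rewrite /= in_itv/= => tE; rewrite lee_fin sin_ge0_pi//; lra.
- exact: (@continuous_EFin_measurable _ _ _ (@continuous_sin R)).
- by rewrite mulr_ge0.
by rewrite integral_sin ?cos0 -?EFinM//; case/andP: rpi.
Qed.

End ZonalBounds.

(** * Chords, nodes and closed curves *)

Section Curves.
Variable R : realType.
Local Notation M := (measurableTypeR R).
Local Notation vec := (R * R * R)%type.

Lemma limn_einf_ge (u : (\bar R)^nat) (a : \bar R) N :
  (forall n, (N <= n)%N -> a <= u n)%E -> (a <= limn_einf u)%E.
Proof.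
move=> au; rewrite limn_einf_lim; apply: lime_ge; first exact: is_cvg_einfs.
exists N => // n /= Nn; apply: le_ereal_inf_tmp => _ [m /= nm <-].
by apply: au; exact: leq_trans nm.
Qed.

Lemma limn_einf_le (u : (\bar R)^nat) (b : \bar R) N :
  (forall n, (N <= n)%N -> u n <= b)%E -> (limn_einf u <= b)%E.
Proof.
move=> ub; rewrite limn_einf_lim; apply: lime_le; first exact: is_cvg_einfs.
exists N => // n /= Nn; apply: le_trans (ub n Nn).
by apply: ereal_inf_lbound; exists n => /=.
Qed.

(** This is x <= tan x; the difference has derivative x sin x. *)
Lemma mulr_cos_le_sin (x : R) : 0 <= x -> x <= pi / 2 -> x * cos x <= sin x.
Proof.
move=> x0 xpi; rewrite -subr_ge0.
have p0 := pi_ge0 R.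
pose f (y : R) := sin y - y * cos y.
have d (y : R) : is_derive y (1 : R) f (y * sin y).
  have -> : f = (@sin R - (@id R * @cos R))%R by [].
  apply: is_derive_eq.
  by rewrite /GRing.scale/= mulr1 mulrN opprD opprK addrCA subrr addr0.
have -> : 0 = f 0 by rewrite /f sin0 mul0r subr0.
apply: (@ger0_derive1_ndecr _ f 0 (pi / 2)) => //.
- move=> y; rewrite in_itv/= => /andP[y0 y1].
  rewrite derive1E derive_val mulr_ge0 ?(ltW y0)//.
  by apply: sin_ge0_pi; lra.
- apply: continuous_subspaceT => y; apply: cvgB; first exact: continuous_sin.
  by apply: cvgM; [exact: cvg_id|exact: continuous_cos].
Qed.

(** With x half the angle, the chord is 2 sin x, and q <= cos x by the hypothesis
    on s; conclude by x cos x <= sin x. Letting q tend to 1 compares angles with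
    chords in the limit of short chords. *)
Lemma angle_le_chord (q s : R) : 0 <= q -> -1 <= s <= 1 -> 2 * q ^+ 2 - 1 <= s ->
  q * acos s <= Num.sqrt (2 - 2 * s).
Proof.
move=> q0 s1 qs; set x := acos s / 2.
have p0 := pi_ge0 R.
have xpi : 0 <= x <= pi / 2.
  by have := acos_ge0 s1; have := acos_lepi s1; rewrite /x; lra.
have sx : 0 <= sin x by apply: sin_ge0_pi; lra.
have cx : 0 <= cos x by apply: cos_ge0_pihalf; lra.
have sE : s = 2 * cos x ^+ 2 - 1.
  have -> : s = cos (x *+ 2) by rewrite -mulr_natr /x divfK// acosK// in_itv.
  by rewrite cos_mulr2n mulr_natl.
have qc : q <= cos x.
  by rewrite -(@ler_pXn2r _ 2)// ?nnegrE//; lra.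
have -> : 2 - 2 * s = (2 * sin x) ^+ 2.
  by rewrite exprMn sin2cos2 sE; ring.
rewrite sqrtr_sqr ger0_norm ?mulr_ge0//.
have -> : acos s = 2 * x by rewrite /x mulrC divfK.
rewrite mulrCA ler_pM2l//; apply: le_trans (mulr_cos_le_sin _ _); [|lra|lra].
by rewrite mulrC ler_wpM2l//; lra.
Qed.

(** A closed walk that visits two values travels between them at least twice. *)
Lemma closed_variation (a : nat -> R) N i j : a 0%N = a N -> (i <= N)%N -> (j <= N)%N ->
  2 * `|a i - a j| <= \sum_(k < N) `|a k - a k.+1|.
Proof.
move=> a0N; wlog ij : i j / (i <= j)%N.
  move=> h iN jN; case: (leqP i j) => [/h|/ltnW /h]; first by apply.
  by rewrite distrC; apply.
move=> iN jN.
have seg m n : (m <= n)%N -> `|a m - a n| <= \sum_(m <= k < n) `|a k - a k.+1|.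
  move=> mn; rewrite distrC -telescope_sumr//; apply: le_trans (ler_norm_sum _ _ _) _.
  by apply: ler_sum => k _; rewrite distrC.
have -> : \sum_(k < N) `|a k - a k.+1| = \sum_(0 <= k < N) `|a k - a k.+1|.
  by rewrite big_mkord.
rewrite (@big_cat_nat _ _ _ i)//= (@big_cat_nat _ _ _ j i)//=.
have := seg _ _ (leq0n i); have := seg _ _ ij; have := seg _ _ jN.
have := ler_distD (a 0%N) (a i) (a j).
rewrite {2}a0N (distrC (a i) (a 0%N)) (distrC (a N)).
lra.
Qed.

Definition ramp (c e t : R) : R := Num.min 1 (Num.max 0 ((t - c) / e)).

Lemma ramp_soft_step (c e : R) : 0 < e -> soft_step (ramp c e) c.
Proof.
move=> e0; split.
- move=> t.
  apply: (@continuous_min _ _ (cst 1) (fun t => Num.max 0 ((t - c) / e)));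
    first exact: cvg_cst.
  apply: (@continuous_max _ _ (cst 0) (fun t => (t - c) / e)); first exact: cvg_cst.
  by apply: cvgM; [apply: cvgB; [exact: cvg_id|exact: cvg_cst]|exact: cvg_cst].
- move=> x y xy; rewrite /ramp le_min !ge_min lexx /= le_max !ge_max !le_max !lexx /=.
  by rewrite ler_pM2r ?invr_gt0// lerD2r xy !orbT.
- by move=> x; rewrite /ramp le_min ler01 le_max lexx ge_min lexx.
- move=> x xc; rewrite /ramp max_l ?min_r//.
  by rewrite mulr_le0_ge0 ?invr_ge0 ?(ltW e0)// subr_le0.
Qed.

Lemma ramp1 (c e t : R) : 0 < e -> c + e <= t -> ramp c e t = 1.
Proof.
move=> e0 t1; rewrite /ramp min_l// le_max; apply/orP; right.
by rewrite ler_pdivlMr// mul1r; lra.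
Qed.

Lemma heine (f : R -> R) : {within `[0, 1], continuous f} -> forall e : R, 0 < e ->
  exists2 d, 0 < d &
  forall s t, 0 <= s <= 1 -> 0 <= t <= 1 -> `|s - t| < d -> `|f s - f t| < e.
Proof.
move=> cf e e0.
have cov := (near_covering_withinP _).2
  ((compact_near_coveringP _).1 (@segment_compact R 0 1)).
have := cov R (0%R^'+) (fun d s =>
  forall t, `[0, 1]%classic t -> `|s - t| < d -> `|f s - f t| < e) _.
case.
  move=> x x01.
  have fx : f y @[y --> within `[0, 1]%classic (nbhs x)] --> f x.
    exact: (subspace_continuousP _ _).1 cf x x01.
  have e2 : 0 < e / 2 by rewrite divr_gt0.
  move/cvgr_dist_lt : fx => /(_ _ e2) /nbhs_ballP[r /= r0 xr].
  have r2 : 0 < r / 2 by rewrite divr_gt0.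
  exists (ball x (r / 2), [set d | d < r / 2]); first split => /=.
  - exact: nbhsx_ballx.
  - exact: nbhs_right_lt.
  - move=> [s d] [/= xs dr] s01 t t01 st.
    have xs' : `|x - s| < r by apply: lt_trans xs _; lra.
    have xt' : `|x - t| < r.
      have := ler_distD s x t; have : `|x - s| < r / 2 by exact: xs.
      by lra.
    have := xr s xs' s01; have := xr t xt' t01; rewrite /=.
    have := ler_distD (f x) (f s) (f t); rewrite (distrC (f s) (f x)); lra.
move=> d0 /= d00 H.
have d2 : 0 < d0 / 2 by rewrite divr_gt0.
exists (d0 / 2) => // s t s01 t01 st.
apply: (H (d0 / 2)) => //=; rewrite ?in_itv//=.
by rewrite sub0r normrN gtr0_norm//; lra.
Qed.

Definition coords (x : 'rV[R]_3) : vec :=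
  (x ord0 ord0, x ord0 (lift ord0 ord0), x ord0 (lift ord0 (lift ord0 ord0))).

Lemma inner_dot x y : inner x y = dot (coords x) (coords y).
Proof. by rewrite /inner !big_ord_recl big_ord0 addr0 addrA. Qed.

Lemma coords_spherical p : coords (spherical_coordinates p) = sphere_point p :> vec.
Proof. by rewrite /coords /spherical_coordinates !mxE. Qed.

Lemma unit_sphere_dot x : unit_sphere R x -> dot (coords x) (coords x) = 1.
Proof.
rewrite /unit_sphere /= /euclidean_norm -inner_dot => h.
have : 0 <= inner x x by apply: sumr_ge0 => i _; rewrite -expr2 sqr_ge0.
by move=> i0; rewrite -(sqr_sqrtr i0) h expr1n.
Qed.

Lemma chord_length x y : unit_sphere R x -> unit_sphere R y ->
  euclidean_norm (y - x) = Num.sqrt (2 - 2 * dot (coords x) (coords y)).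
Proof.
move=> /unit_sphere_dot x1 /unit_sphere_dot y1; congr Num.sqrt.
rewrite inner_dot.
transitivity (dot (coords x) (coords x) + dot (coords y) (coords y) -
  2 * dot (coords x) (coords y)); last by rewrite x1 y1.
by rewrite /dot /coords /= !mxE; ring.
Qed.

Lemma nearest_node (t : R) n : 0 <= t <= 1 ->
  exists2 k, (k <= n.+1)%N & `|k%:R / n.+1%:R - t| <= n.+1%:R^-1.
Proof.
move=> /andP[t0 t1]; have n0 : 0 < n.+1%:R :> R by [].
have /andP[k1 k2] := Num.Theory.truncn_itv (mulr_ge0 t0 (ltW n0)).
set k := Num.truncn _ in k1 k2.
exists k.
  by rewrite -(ler_nat R) (le_trans k1)// ler_piMl// ltW.
have -> : k%:R / n.+1%:R - t = (k%:R - t * n.+1%:R) / n.+1%:R by field; rewrite gt_eqF.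
rewrite normrM (ger0_norm (_ : 0 <= n.+1%:R^-1)) ?invr_ge0// ler_piMl ?invr_ge0//.
by rewrite ler_norml; move: k2; rewrite -natr1; lra.
Qed.

Definition nodes n : seq R := mkseq (fun k => k.+1%:R / n.+1%:R) n.+1.

Lemma nth_nodes n k : (k <= n.+1)%N -> nth 1 (0 :: nodes n) k = k%:R / n.+1%:R.
Proof.
case: k => [|k] kn; first by rewrite mul0r.
by rewrite /= nth_mkseq.
Qed.

Lemma nodes_partition n : itv_partition 0 1 (nodes n).
Proof.
split.
  apply/(pathP 1) => i; rewrite size_mkseq => iN.
  rewrite nth_nodes; last exact: ltnW.
  by rewrite nth_mkseq// ltr_pM2r ?invr_gt0// ltr_nat.
rewrite (last_nth 1) size_mkseq nth_nodes// divff// pnatr_eq0.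
Qed.

Lemma unit_coord_le1 (v : vec) : dot v v = 1 ->
  [/\ `|v.1.1| <= 1, `|v.1.2| <= 1 & `|v.2| <= 1].
Proof.
rewrite /dot -!expr2 => v1; have := sqr_ge0 v.1.1; have := sqr_ge0 v.1.2; have := sqr_ge0 v.2.
move=> *; split; rewrite -(@ler_pXn2r _ 2)// ?nnegrE// expr1n real_normK ?num_real//; lra.
Qed.

(** Uniform continuity of the curve, in the form in which it is used: uniformly
    in the unit vector v as well. *)
Lemma dot_uniform (gamma : R -> 'rV[R]_3) : {within `[0, 1], continuous gamma} ->
  forall e : R, 0 < e -> exists N, forall n, (N <= n)%N ->
  forall s t, 0 <= s <= 1 -> 0 <= t <= 1 ->
    `|s - t| <= n.+1%:R^-1 -> forall v, dot v v = 1 ->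
    `|dot v (coords (gamma s)) - dot v (coords (gamma t))| <= e.
Proof.
move=> cg e e0.
have ci i : {within `[0, 1], continuous (fun t => gamma t ord0 i)}.
  apply/subspace_continuousP => x Ax.
  have H := (subspace_continuousP _ _).1 cg x Ax.
  have K : continuous (fun v : 'rV[R]_3 => v ord0 i) by exact: coord_continuous.
  exact: (cvg_comp _ _ H (K _)).
have e3 : 0 < e / 3 by rewrite divr_gt0.
have [d1 d10 h1] := heine (ci ord0) e3.
have [d2 d20 h2] := heine (ci (lift ord0 ord0)) e3.
have [d3 d30 h3] := heine (ci (lift ord0 (lift ord0 ord0))) e3.
have d0 : 0 < Num.min d1 (Num.min d2 d3) by rewrite !lt_min d10 d20.
have [N _ HN] := near_infty_natSinv_lt (PosNum d0).
exists N => n Nn s t s01 t01 st v v1.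
have := HN n Nn; rewrite /= !lt_min => /and3P[n1 n2 n3].
have [a1 a2 a3] := unit_coord_le1 v1.
have {}h1 := h1 s t s01 t01 (le_lt_trans st n1).
have {}h2 := h2 s t s01 t01 (le_lt_trans st n2).
have {}h3 := h3 s t s01 t01 (le_lt_trans st n3).
have b (x y : R) : `|x| <= 1 -> `|y| < e / 3 -> `|x * y| <= e / 3.
  by move=> x1 y3; rewrite normrM -[leRHS]mul1r ler_pM// ltW.
have := b _ _ a1 h1; have := b _ _ a2 h2; have := b _ _ a3 h3.
rewrite /dot /coords /= !ler_norml !mulrBr => /andP[? ?] /andP[? ?] /andP[? ?].
by apply/andP; split; lra.
Qed.

(** The nodes form a partition of [0, 1], so the sum of the chords is at most L. *)
Lemma sum_angles_le (gamma : R -> 'rV[R]_3) (L q : R) n :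
  (forall t, 0 <= t <= 1 -> unit_sphere R (gamma t)) ->
  curve_length gamma = L%:E -> 0 <= q ->
  let g k := coords (gamma (k%:R / n.+1%:R)) in
  (forall k, (k < n.+1)%N -> 2 * q ^+ 2 - 1 <= dot (g k) (g k.+1)) ->
  q * (\sum_(k < n.+1) acos (dot (g k) (g k.+1))) <= L.
Proof.
move=> sph len q0 g hq.
have node k : (k <= n.+1)%N -> unit_sphere R (gamma (k%:R / n.+1%:R)).
  move=> kn; apply: sph; rewrite divr_ge0//= ler_pdivrMr// mul1r ler_nat//.
have pl : polygon_length gamma (nodes n) <= L.
  rewrite -lee_fin -len; apply: ereal_sup_ubound; exists (nodes n) => //.
  exact: nodes_partition.
apply: le_trans pl; rewrite mulr_sumr /polygon_length size_mkseq.
apply: ler_sum => k _; rewrite !nth_nodes//; last exact: ltnW.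
rewrite chord_length; [|exact: node (ltnW (ltn_ord k))|exact: node].
apply: angle_le_chord => //; last exact: hq.
by apply: dot_unit_itv; apply: unit_sphere_dot; apply: node => //; exact: ltnW.
Qed.

Lemma tube_close_point (gamma : R -> 'rV[R]_3) (C : set 'rV[R]_3) (theta tau : R) p :
  C = gamma @` `[0, 1] -> C `<=` unit_sphere R -> theta < tau -> 0 <= tau <= pi ->
  tube C theta (spherical_coordinates p) ->
  exists2 t, 0 <= t <= 1 & cos tau < dot (sphere_point p) (coords (gamma t)).
Proof.
move=> CE Cs tt tpi [pu dp].
set S := [set acos (inner (spherical_coordinates p) y) | y in C] in dp.
have S0 y : C y -> -1 <= inner (spherical_coordinates p) y <= 1.
  move=> /Cs /unit_sphere_dot y1; rewrite inner_dot.
  by apply: dot_unit_itv => //; exact: unit_sphere_dot.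
have infS : has_inf S.
  split.
    exists (acos (inner (spherical_coordinates p) (gamma 0))); exists (gamma 0) => //.
    by rewrite CE; exists 0 => //=; rewrite in_itv/= lexx ler01.
  by exists 0 => _ [y Cy <-]; apply: acos_ge0; exact: S0.
have e0 : 0 < tau - theta by rewrite subr_gt0.
have [_ [y Cy <-] hy] := inf_adherent e0 infS.
have : acos (inner (spherical_coordinates p) y) < tau.
  by apply: lt_le_trans hy _; move: dp; rewrite /sphere_dist -/S; lra.
have := S0 _ Cy; move: (Cy); rewrite CE => -[t t01 <-] y1 ya.
exists t => //; rewrite -coords_spherical -inner_dot -[ltRHS]acosK ?in_itv//.
by rewrite ltr_cos// in_itv/= ?acos_ge0 ?acos_lepi.
Qed.

Lemma sphere_integral_half_sum n (phi : nat -> vec -> R) :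
  (forall k, admissible (phi k)) ->
  sphere_integral (fun v => 2^-1 * \sum_(k < n) phi k v) =
  (2^-1%:E * \sum_(k < n) sphere_integral (phi k))%E.
Proof.
move=> aphi.
have mD : measurable (@coordinates_domain R : set (M * M)).
  by apply: measurableX; exact: measurable_itv.
have phi0 k p : (@coordinates_domain R) p -> (0 <= (phi k (sphere_point p) * sin p.1)%:E)%E.
  move=> [/= + _]; rewrite in_itv/= => p1.
  by rewrite lee_fin mulr_ge0 ?sin_ge0_pi//; case: (aphi k).
rewrite /sphere_integral.
under eq_integral => p _ do rewrite -mulrA mulr_suml EFinM -sumEFin.
rewrite ge0_integralZl_EFin//; last 2 first.
- by move=> p Dp; apply: sume_ge0 => k _; exact: phi0.
- apply: emeasurable_sum => k; apply: measurable_funTS.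
  exact: measurable_sphere_integrand.
rewrite ge0_integral_sum//.
- by move=> k; apply: measurable_funTS; exact: measurable_sphere_integrand.
- by move=> k p; exact: phi0.
Qed.

End Curves.

(** * The area of a tube *)

Section Tubes.
Variable R : realType.
Local Notation mu := (@lebesgue_measure R).
Local Notation M := (measurableTypeR R).
Local Notation vec := (R * R * R)%type.

Lemma dotC (a b : vec) : dot a b = dot b a.
Proof. by rewrite /dot; ring. Qed.

(** If x and y are within sigma of z, with cos sigma = c, then they are within
    2 sigma of each other. The inequality expresses that x + y - s z has
    nonnegative square norm, where s is the sum of the two inner products with z. *)
Lemma dot_double_angle (x y z : vec) c : dot x x = 1 -> dot y y = 1 -> dot z z = 1 ->
  0 <= c -> c <= dot x z -> c <= dot y z -> 2 * c ^+ 2 - 1 <= dot x y.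
Proof.
move=> x1 y1 z1 c0 xz yz; set s := dot x z + dot y z.
have key : 0 <= 2 + 2 * dot x y - s ^+ 2.
  have -> : 2 + 2 * dot x y - s ^+ 2 =
      dot x x + dot y y + 2 * dot x y - 2 * s * s + s ^+ 2 * dot z z.
    by rewrite x1 y1 z1; ring.
  have -> : dot x x + dot y y + 2 * dot x y - 2 * s * s + s ^+ 2 * dot z z =
      (x.1.1 + y.1.1 - s * z.1.1) ^+ 2 + (x.1.2 + y.1.2 - s * z.1.2) ^+ 2 +
      (x.2 + y.2 - s * z.2) ^+ 2.
    by rewrite {2}/s /dot; ring.
  by rewrite !addr_ge0 ?sqr_ge0.
have : (2 * c) ^+ 2 <= s ^+ 2 by rewrite ler_pXn2r// ?nnegrE /s; lra.
by rewrite exprMn; lra.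
Qed.

Lemma sphere_area_le_integral (E : set 'rV[R]_3) (f : vec -> R) : (forall v, 0 <= f v) ->
  (forall p, E (spherical_coordinates p) -> 1 <= f (sphere_point p)) ->
  (sphere_area E <= sphere_integral f)%E.
Proof.
move=> f0 fE; apply: ge0_le_integral_any => -[t u]; rewrite !patchE.
case: ifPn => [|_].
  rewrite inE => -[[/=]]; rewrite !in_itv/= => t0 u0 /fE f1.
  have s0 : 0 <= sin t by exact: sin_ge0_pi.
  rewrite ifT ?lee_fin ?s0 /= ?lee_fin ?ler_peMl//.
  by rewrite inE; split; rewrite /= in_itv.
rewrite lexx /=; case: ifPn => //; rewrite inE => -[/= + _]; rewrite in_itv/= => t0.
by rewrite lee_fin mulr_ge0// sin_ge0_pi.
Qed.

Lemma sphere_area_le_4pi (E : set 'rV[R]_3) : (sphere_area E <= (4 * pi)%:E)%E.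
Proof.
apply: (@le_trans _ _ (sphere_integral (fun=> 1))); first exact: sphere_area_le_integral.
rewrite sphere_integralE; last by apply: admissible_tame => //; exact: tame_cst.
have p0 := pi_gt0 R.
under eq_integral => t _.
  rewrite integral_cst//= lebesgue_measure_itv/= lte_fin mulr_gt0// -EFinB.
  rewrite subr0 mul1r muleC; over.
rewrite ge0_integralZl_EFin//; last 3 first.
- by move=> t; rewrite /= in_itv/= => t0; rewrite lee_fin sin_ge0_pi.
- exact: (@continuous_EFin_measurable _ _ _ (@continuous_sin R)).
- by rewrite mulr_ge0// ltW.
by rewrite integral_sin// cos0 cospi -EFinM lee_fin; lra.
Qed.

Lemma area_in_cap (E : set 'rV[R]_3) (v0 : vec) (sigma tau : R) :
  0 <= sigma < tau -> tau < pi / 2 -> dot v0 v0 = 1 ->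
  (forall p, E (spherical_coordinates p) -> cos (2 * sigma) <= dot v0 (sphere_point p)) ->
  (sphere_area E <= (4 * pi * sin tau ^+ 2)%:E)%E.
Proof.
move=> st tpi v1 hE.
have cc : cos (2 * tau) < cos (2 * sigma) by rewrite ltr_cos ?in_itv/=; lra.
have e0 : 0 < cos (2 * sigma) - cos (2 * tau) by rewrite subr_gt0.
have hs := ramp_soft_step (cos (2 * tau)) e0.
set h := ramp _ _ in hs.
have -> : 4 * pi * sin tau ^+ 2 = 2 * pi * (1 - cos (2 * tau)).
  by rewrite [2 * tau]mulr_natl cos_mulr2n sin2cos2 -mulr_natl; ring.
apply: le_trans (cap_bound hs _ v1); last by lra.
have [_ _ h01 _] := hs.
apply: sphere_area_le_integral => [v|p /hE hp]; first by have /andP[] := h01 (dot v0 v).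
by rewrite /h ramp1//; lra.
Qed.

Definition curve_node (gamma : R -> 'rV[R]_3) (n k : nat) : vec :=
  coords (gamma (k%:R / n.+1%:R)).

(** A smoothed indicator that the circle of angular radius sigma about v separates
    the nodes k and k + 1; the ramp sharpens as the nodes get closer. *)
Definition crossing (gamma : R -> 'rV[R]_3) (sigma : R) (n k : nat) (v : vec) : R :=
  `|ramp (cos sigma) n.+1%:R^-1 (dot (curve_node gamma n k) v) -
    ramp (cos sigma) n.+1%:R^-1 (dot (curve_node gamma n k.+1) v)|.

Definition half_crossings (gamma : R -> 'rV[R]_3) (sigma : R) (n : nat) (v : vec) : R :=
  2^-1 * \sum_(k < n.+1) crossing gamma sigma n k v.

Lemma node_itv n k : (k <= n.+1)%N -> 0 <= (k%:R / n.+1%:R : R) <= 1.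
Proof. by move=> kn; rewrite divr_ge0//= ler_pdivrMr// mul1r ler_nat. Qed.

Lemma soft_step_nat (c : R) n : soft_step (ramp c n.+1%:R^-1) c.
Proof. by apply: ramp_soft_step; rewrite invr_gt0. Qed.

Lemma tame_sum n (F : nat -> vec -> R) : (forall k, tame (F k)) ->
  tame (fun v => \sum_(k < n) F k v).
Proof.
move=> tF; elim: n => [|n IH].
  have -> : (fun v => \sum_(k < 0) F k v) = (fun=> 0).
    by apply/funext => v; rewrite big_ord0.
  exact: tame_cst.
have -> : (fun v => \sum_(k < n.+1) F k v) = (fun v => \sum_(k < n) F k v + F n v).
  by apply/funext => v; rewrite big_ord_recr.
exact: tameD.
Qed.

Lemma admissible_crossing gamma sigma n k : admissible (crossing gamma sigma n k).
Proof.
have [ch _ _ _] := soft_step_nat (cos sigma) n; rewrite /crossing.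
apply: admissible_tame => //.
apply: (@tame_comp _ (fun x => `|x|)); first exact: norm_continuous.
apply: tameD; first by apply: tame_comp => //; exact: tame_dot.
apply: (@tame_comp _ -%R); first exact: opp_continuous.
by apply: tame_comp => //; exact: tame_dot.
Qed.

(** [crofton_bound] for each chord gives 2 sin sigma times the sum of the angles
    between consecutive nodes. Since sigma < tau, the ratio
    q = sin sigma / sin tau is less than 1, so for fine partitions q times that
    sum is at most L. *)
Lemma integral_half_crossings (gamma : R -> 'rV[R]_3) (L sigma tau : R) :
  {within `[0, 1], continuous gamma} ->
  (forall t, 0 <= t <= 1 -> unit_sphere R (gamma t)) ->
  curve_length gamma = L%:E -> 0 < sigma < tau -> tau < pi / 2 ->
  exists N, forall n, (N <= n)%N ->
  (sphere_integral (half_crossings gamma sigma n) <= (2 * L * sin tau)%:E)%E.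
Proof.
move=> gamma_cont gamma_sphere gamma_length st tpi; have p0 := pi_gt0 R.
have ss : 0 < sin sigma by apply: sin_gt0_pi; lra.
have sst : sin sigma < sin tau.
  by rewrite ltr_sin ?in_itv/=; lra.
pose q := sin sigma / sin tau.
have q0 : 0 < q by rewrite divr_gt0//; lra.
have q1 : q < 1 by rewrite ltr_pdivrMr ?mul1r//; lra.
have e0 : 0 < 2 - 2 * q ^+ 2.
  have : q ^+ 2 < 1 by rewrite expr_lt1// ltW.
  by lra.
have g_unit n k : (k <= n.+1)%N -> dot (curve_node gamma n k) (curve_node gamma n k) = 1.
  by move=> kn; apply/unit_sphere_dot/gamma_sphere/node_itv.
have [N HN] := dot_uniform gamma_cont e0.
exists N => n Nn.
pose g := curve_node gamma n.
have sums : q * (\sum_(k < n.+1) acos (dot (g k) (g k.+1))) <= L.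
  apply: (sum_angles_le gamma_sphere gamma_length (ltW q0)) => k kn.
  have := HN n Nn _ _ (node_itv (ltnW kn)) (node_itv kn) _ _ (g_unit n k (ltnW kn)).
  rewrite -mulrBl -natr1 opprD addrA subrr sub0r mulN1r normrN.
  rewrite ger0_norm ?invr_ge0// lexx => /(_ isT).
  rewrite -/(curve_node gamma n k) natr1 -/(curve_node gamma n k.+1) g_unit ?(ltnW kn)//.
  by rewrite ler_norml /g /curve_node; lra.
rewrite sphere_integral_half_sum; last exact: admissible_crossing.
apply: (@le_trans _ _ (2^-1%:E * \sum_(k < n.+1)
    (4 * acos (dot (g k) (g k.+1)) * sin sigma)%:E)%E).
  rewrite lee_wpmul2l// ?lee_fin//; apply: lee_sum => k _.
  apply: (crofton_bound (soft_step_nat (cos sigma) n)); first by lra.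
  - by apply: g_unit; exact: ltnW.
  - exact: g_unit.
rewrite sumEFin -EFinM lee_fin -mulr_suml -mulr_sumr.
have -> : 2 * L * sin tau = 2 * (L / q) * sin sigma.
  by rewrite /q; field; rewrite !gt_eqF//; lra.
rewrite mulrA ler_pM2r// mulrA (_ : 2^-1 * 4 = 2); last by field.
by rewrite ler_pM2l// ler_pdivlMr// mulrC.
Qed.

(** Nodes close to the two given points of the curve take the ramp to the values
    1 and 0; the curve is closed, so it crosses between them twice. *)
Lemma half_crossings_ge1 (gamma : R -> 'rV[R]_3) (sigma : R) (v : vec) :
  {within `[0, 1], continuous gamma} -> gamma 0 = gamma 1 -> dot v v = 1 ->
  (exists2 t, 0 <= t <= 1 & cos sigma < dot v (coords (gamma t))) ->
  (exists2 t, 0 <= t <= 1 & dot v (coords (gamma t)) < cos sigma) ->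
  exists N, forall n, (N <= n)%N -> 1 <= half_crossings gamma sigma n v.
Proof.
move=> gamma_cont gamma_closed v1 [t t01 ht] [s s01 hsg].
set a := dot v _ in ht; set b := dot v _ in hsg.
have e0 : 0 < Num.min ((a - cos sigma) / 2) (cos sigma - b).
  by rewrite lt_min; apply/andP; split; lra.
have [N1 H1] := dot_uniform gamma_cont e0.
have [N2 _ H2] := near_infty_natSinv_lt (PosNum e0).
exists (maxn N1 N2) => n; rewrite geq_max => /andP[n1 n2].
have := H2 n n2; rewrite /= lt_min => /andP[m1 m2].
have [i iN it] := nearest_node n t01.
have [j jN js] := nearest_node n s01.
have := H1 n n1 _ _ (node_itv iN) t01 it v v1.
have := H1 n n1 _ _ (node_itv jN) s01 js v v1.
rewrite -/a -/b -/(curve_node gamma n i) -/(curve_node gamma n j) !le_min !ler_norml.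
move=> /andP[_ gj] /andP[gi _].
pose h := ramp (cos sigma) n.+1%:R^-1.
have hi : h (dot (curve_node gamma n i) v) = 1.
  rewrite /h ramp1 ?invr_gt0// dotC; move: gi m1; clear.
  by move: (dot v _) (n.+1%:R^-1) => x w *; lra.
have hj : h (dot (curve_node gamma n j) v) = 0.
  by have [_ _ _ h0] := soft_step_nat (cos sigma) n; rewrite /h h0// dotC; lra.
have closed : h (dot (curve_node gamma n 0) v) = h (dot (curve_node gamma n n.+1) v).
  by rewrite /curve_node mul0r divff ?pnatr_eq0// gamma_closed.
have := closed_variation (a := fun k => h (dot (curve_node gamma n k) v)) closed iN jN.
rewrite /= hi hj subr0 normr1 mulr1 /half_crossings => H.
by rewrite -(ler_pM2l (ltr0n R 2)) mulr1 mulrA divff// mul1r.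
Qed.

(** By [half_crossings_ge1] the lower limit of the half crossing counts is at least
    1 on E; Fatou's lemma and [integral_half_crossings] bound its integral. *)
Lemma area_uncovered_curve (gamma : R -> 'rV[R]_3) (L sigma tau : R) (E : set 'rV[R]_3) :
  {within `[0, 1], continuous gamma} -> gamma 0 = gamma 1 ->
  (forall t, 0 <= t <= 1 -> unit_sphere R (gamma t)) ->
  curve_length gamma = L%:E -> 0 < sigma < tau -> tau < pi / 2 ->
  (forall p, E (spherical_coordinates p) ->
    (exists2 t, 0 <= t <= 1 & cos sigma < dot (sphere_point p) (coords (gamma t))) /\
    (exists2 t, 0 <= t <= 1 & dot (sphere_point p) (coords (gamma t)) < cos sigma)) ->
  (sphere_area E <= (2 * L * sin tau)%:E)%E.
Proof.
move=> gc g01 gs len st tpi hE; pose f := half_crossings gamma sigma.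
have af n : admissible (f n).
  apply: admissible_tame; last first.
    by move=> v; rewrite mulr_ge0// sumr_ge0// => k _; exact: normr_ge0.
  apply: tameM; first exact: tame_cst.
  apply: (@tame_sum _ (crossing gamma sigma n)) => k.
  by apply: tame_admissible; exact: admissible_crossing.
have mD : measurable (@coordinates_domain R : set (M * M)).
  by apply: measurableX; exact: measurable_itv.
have f0 n p : (@coordinates_domain R) p -> (0 <= (f n (sphere_point p) * sin p.1)%:E)%E.
  move=> [/= + _]; rewrite in_itv/= => p1.
  by rewrite lee_fin mulr_ge0 ?sin_ge0_pi//; case: (af n).
apply: (@le_trans _ _ (\int[(mu \x mu)%E]_(p in @coordinates_domain R)
    limn_einf (fun n => (f n (sphere_point p) * sin p.1)%:E))%E).
  apply: ge0_le_integral_any => p; rewrite !patchE.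
  case: ifPn => [|_].
    rewrite inE => -[pD /= /hE [h1 h2]].
    rewrite ifT ?inE//.
    have s0 : 0 <= sin p.1.
      by case: pD => /= + _; rewrite in_itv/= => ?; exact: sin_ge0_pi.
    rewrite lee_fin s0 /=.
    have [N HN] := half_crossings_ge1 gc g01 (sqnorm_sphere_point p) h1 h2.
    by apply: (@limn_einf_ge _ _ _ N) => n /HN fn; rewrite lee_fin ler_peMl.
  rewrite lexx /=; case: ifPn => //; rewrite inE => pD.
  by apply: (@limn_einf_ge _ _ _ 0%N) => n _; exact: f0.
apply: le_trans (fatou _ _ _ _) _ => //.
- by move=> n; exact: (measurable_funTS (measurable_sphere_integrand (af n))).
- have [N HN] := integral_half_crossings gc gs len st tpi.
  exact: (@limn_einf_le _ _ _ N).
Qed.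

(** With sigma halfway between theta and tau, every point of the tube is within
    sigma of the curve, strictly. *)
Lemma tube_area_le_sin (C : set 'rV[R]_3) (gamma : R -> 'rV[R]_3) (L theta tau : R) :
  C `<=` unit_sphere R -> simple_closed_curve gamma C -> curve_length gamma = L%:E ->
  2 * pi <= L -> 0 <= theta < tau -> tau < pi / 2 ->
  (tube_area C theta <= (2 * L * sin tau)%:E)%E.
Proof.
move=> Cs [gc g01 _ CE] len Lpi tt tpi.
have p0 := pi_gt0 R.
pose sigma := (theta + tau) / 2.
have ts : theta < sigma by rewrite /sigma; lra.
have st : 0 < sigma < tau by rewrite /sigma; apply/andP; split; lra.
have gs t : 0 <= t <= 1 -> unit_sphere R (gamma t).
  by move=> t01; apply: Cs; rewrite CE; exists t => //=; rewrite in_itv.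
have near p := tube_close_point (p := p) CE Cs ts (_ : 0 <= sigma <= pi).
have {}near p : tube C theta (spherical_coordinates p) ->
    exists2 t, 0 <= t <= 1 & cos sigma < dot (sphere_point p) (coords (gamma t)).
  by apply: near; lra.
have c0 : 0 <= cos sigma by apply: cos_ge0_pihalf; lra.
case: (pselect (exists2 v : vec, dot v v = 1 &
    forall t, 0 <= t <= 1 -> cos sigma <= dot v (coords (gamma t)))).
  move=> [v v1 hv].
  apply: (@le_trans _ _ (4 * pi * sin tau ^+ 2)%:E).
    apply: (@area_in_cap _ v sigma) => //; first by lra.
    move=> p /near [t t01 pt]; rewrite [2 * sigma]mulr_natl cos_mulr2n -mulr_natl.
    apply: (@dot_double_angle _ _ (coords (gamma t))) => //; last 2 first.
    + exact: hv.
    + exact: ltW.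
    + exact: sqnorm_sphere_point.
    + exact/unit_sphere_dot/gs.
  rewrite lee_fin expr2 mulrA ler_wpM2r//; first by apply: sin_ge0_pi; lra.
  apply: (@le_trans _ _ (4 * pi)); last by lra.
  by rewrite ler_piMr ?sin_le1// mulr_ge0// ltW.
move=> ncap; apply: (@area_uncovered_curve gamma L sigma) => // p pt.
split; first exact: near.
apply: contrapT => np; apply: ncap; exists (sphere_point p).
  exact: sqnorm_sphere_point.
by move=> t t01; rewrite leNgt; apply/negP => lt; apply: np; exists t.
Qed.

End Tubes.

Theorem proposition6 (R : realType) (C : set 'rV[R]_3) (gamma : R -> 'rV[R]_3)
    (L vartheta theta : R)
    (C_sphere : C `<=` unit_sphere R)
    (C_curve : simple_closed_curve gamma C)
    (C_length : curve_length gamma = L%:E)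
    (L_ge : 2 * pi <= L)
    (vartheta_itv : 0 < vartheta <= pi / 2)
    (vartheta_sin : sin vartheta = 2 * pi / L)
    (theta_itv : 0 <= theta <= vartheta) :
  (tube_area C theta <= (2 * L * sin theta)%:E)%E.
Proof.
have p0 := pi_gt0 R.
have [th|th] := ltP theta (pi / 2); last first.
  have -> : theta = pi / 2 by lra.
  rewrite sin_pihalf; apply: le_trans (sphere_area_le_4pi _) _.
  by rewrite lee_fin; lra.
apply/lee_addgt0Pr => e e0.
(* The bound with sin tau holds for every tau in ]theta, pi/2[. *)
have cs : 2 * L * sin x @[x --> theta^'+] --> 2 * L * sin theta.
  apply: cvgM; first exact: cvg_cst.
  by apply: cvg_at_right_filter; exact: continuous_sin.
have [tau [tau1 tau2 tau3]] : exists tau,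
    [/\ theta < tau, tau < pi / 2 & 2 * L * sin tau < 2 * L * sin theta + e].
  apply: (@filter_ex _ (theta^'+)); near=> tau; split; near: tau.
  - exact: nbhs_right_gt.
  - exact: nbhs_right_lt.
  - by apply: (cvgr_lt _ cs); rewrite ltrDl.
apply: (@le_trans _ _ (2 * L * sin tau)%:E).
  apply: (tube_area_le_sin C_sphere C_curve C_length L_ge) => //.
  by case/andP: theta_itv => -> _.
by rewrite -EFinD lee_fin ltW.
Unshelve. all: by end_near. Qed.
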